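(* Let $n\ge 4$ be even. Then $IC_n=\langle \mathcal{G}\rangle$, where $\mathcal{G}=\mathcal{A}\cup\mathcal{B}$.
   Context: Let $n\ge 4$ be even and $[n]=\{1,\dots,n\}$. The crown is the partial order $\prec$ on $[n]$ whose only comparabilities are $1\prec 2\succ 3\prec 4\succ\cdots\prec n\succ 1$ (so odd elements are minimal and even elements are maximal). $I_n$ is the symmetric inverse semigroup of all partial injective maps $[n]\to[n]$; maps are written on the right and composed from left to right. $\mathrm{Dom}\,\alpha$ and $\mathrm{Im}\,\alpha$ are the domain and image of $\alpha$. $IC_n$ is the inverse semigroup of all $\alpha\in I_n$ such that for all $x,y\in\mathrm{Dom}\,\alpha$: $x\prec y$ if and only if $x\alpha\prec y\alpha$. For a set $A\subseteq I_n$, $\langle A\rangle$ is the subsemigroup of $I_n$ generated by $A$. Sums and differences used as elements of $[n]$ are reduced modulo $n$ to lie in $[n]$. Permutations: $x\sigma_1=x+2$ (mod $n$) for $x\in[n]$; $1\sigma_2=1$ and $x\sigma_2=n+2-x$ for $2\le x\le n$. For $i\in[n]$, $\varepsilon_i$ is the identity map on $[n]\setminus\{i\}$. For distinct $i,j\in[n]$ of the same parity, $\gamma_{i,j}$ has domain $[n]\setminus\{i,j\}$ and: if $i<j$, then $x\gamma_{i,j}=i+j-x$ for $i<x<j$ and $x\gamma_{i,j}=x$ for $x<i$ or $x>j$; if $j<i$, then $x\gamma_{i,j}=x$ for $j<x<i$ and $x\gamma_{i,j}=i+j-x$ (mod $n$) for $x<j$ or $x>i$. $\mathcal{A}=\{\sigma_1,\sigma_2,\varepsilon_1,\varepsilon_n\}\cup\{\gamma_{i,n}: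 i\text{ even},\ 4\le i\le 2\lfloor n/4\rfloor\}\cup\{\gamma_{i,1}: i\text{ odd},\ 5\le i\le 2\lfloor n/4\rfloor+1\}$. For $1\le i\le \frac n2-1$: $\delta_i^o$ has domain $[n]\setminus\{1,3,n-2i+2\}$ if $i\geq 2$ and $[n]\setminus\{1,3,n\}$ if $i=1$, with $2\delta_i^o=1$, $x\delta_i^o=x+2i-2$ for $4\le x\le n-2i+1$, and $x\delta_i^o=x-n+2i$ for $n-2i+3\le x\le n$. $\delta_i^e$ has domain $[n]\setminus\{2,2i+1,n\}$ if $i\ge2$ and $[n]\setminus\{2,3,n\}$ if $i=1$, with $1\delta_i^e=2$, $x\delta_i^e=x+n-2i$ for $3\le x\le 2i$, and $x\delta_i^e=x-2i+2$ for $2i+2\le x\le n-1$. (An index range with lower bound exceeding upper bound is empty.) $\eta_1$ has domain the odd elements of $[n]$ with $x\eta_1=x+1$; $\eta_2$ has domain the even elements of $[n]$ with $x\eta_2=x-1$. $\mathcal{B}=\{\delta_1^o,\delta_1^e,\eta_1,\eta_2\}\cup\{\delta_i^o,\delta_i^e: 2\le i\le\lfloor n/4\rfloor\}$. *)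

(* Defs.v *)
From HB Require Import structures.
From mathcomp Require Import all_boot all_fingroup.

Set Implicit Arguments.
Unset Strict Implicit.
Unset Printing Implicit Defensive.

(* The point k of [n] = {1, ..., n} is the ordinal of value k - 1; all formulas
   below are written in terms of the label k. *)
Definition label (n : nat) (x : 'I_n) : nat := x.+1.

(* The point of [n] congruent to k modulo n (which exists as soon as 0 < n). *)
Definition point (n k : nat) : option 'I_n := insub ((k + n.-1) %% n).

Definition ptrans (n : nat) : Type := {ffun 'I_n -> option 'I_n}.

HB.instance Definition _ (n : nat) := Finite.copy (ptrans n) {ffun 'I_n -> option 'I_n}.

(* Maps act on the right: x (a b) = (x a) b. *)
Definition ptrans_mul (n : nat) (a b : ptrans n) : ptrans n :=
  [ffun x => obind (fun_of_fin b) (fun_of_fin a x)].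

Definition ptrans_one (n : nat) : ptrans n := [ffun x => Some x].

Lemma ptrans_mulA (n : nat) : associative (@ptrans_mul n).
Proof. by move=> a b c; apply/ffunP => x; rewrite !ffunE; case: (fun_of_fin a x) => //= y; rewrite ffunE. Qed.

Lemma ptrans_mul1 (n : nat) : left_id (@ptrans_one n) (@ptrans_mul n).
Proof. by move=> a; apply/ffunP => x; rewrite !ffunE. Qed.

Lemma ptrans_1mul (n : nat) : right_id (@ptrans_one n) (@ptrans_mul n).
Proof. by move=> a; apply/ffunP => x; rewrite !ffunE; case: (fun_of_fin a x) => //= y; rewrite ffunE. Qed.

HB.instance Definition _ (n : nat) :=
  isMonoid.Build (ptrans n) (@ptrans_mulA n) (@ptrans_mul1 n) (@ptrans_1mul n).

Definition papp (n : nat) (a : ptrans n) (x : 'I_n) : option 'I_n := fun_of_fin a x.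

Definition Dom (n : nat) (a : ptrans n) : {set 'I_n} := [set x | papp a x].

(* The symmetric inverse semigroup I_n, inside the monoid of all partial maps. *)
Definition SymInv (n : nat) : {set ptrans n} :=
  [set a | [forall x in Dom a, forall y in Dom a, (papp a x == papp a y) ==> (x == y)]].

Definition crown (n : nat) (x y : 'I_n) : bool :=
  odd (label x) &&
  [|| label y == (label x).+1, label x == (label y).+1
    | (label x == 1) && (label y == n)].

Definition IC (n : nat) : {set ptrans n} :=
  [set a in SymInv n |
    [forall x, forall y, forall x', forall y',
      (papp a x == Some x') ==> (papp a y == Some y') ==>
      (crown x y == crown x' y')]].

(* Least set of partial maps containing A and closed under composition.  For A
   contained in SymInv n, itself closed under composition, this is the
   subsemigroup of SymInv n generated by A. *)
Definition sgen (n : nat) (A : {set ptrans n}) : {set ptrans n} :=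
  \bigcap_(S : {set ptrans n} |
            (A \subset S) && [forall a in S, forall b in S, (a * b)%g \in S]) S.

(* The partial map sending x to f x modulo n, for x of label satisfying D. *)
Definition mk_ptrans (n : nat) (D : pred nat) (f : nat -> nat) : ptrans n :=
  [ffun x => if D (label x) then point n (f (label x)) else None].

Definition sigma1 (n : nat) : ptrans n := mk_ptrans n predT (fun x => x + 2).

Definition sigma2 (n : nat) : ptrans n :=
  mk_ptrans n predT (fun x => if x == 1 then 1 else n + 2 - x).

Definition epsilon (n i : nat) : ptrans n := mk_ptrans n (fun x => x != i) id.

(* In the last branch n is added because i + j - x may be negative and
   subtraction on nat is truncated. *)
Definition gamma (n i j : nat) : ptrans n :=
  mk_ptrans n (fun x => x \notin [:: i; j])
    (fun x =>
       if i < j then (if i < x < j then i + j - x else x)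
       else (if j < x < i then x else i + j + n - x)).

(* For i = 1 the removed points are 1, 3, n, since then n - 2 * i + 2 = n.
   Terms are ordered so that truncated subtraction is exact. *)
Definition delta_o (n i : nat) : ptrans n :=
  mk_ptrans n (fun x => x \notin [:: 1; 3; n - 2 * i + 2])
    (fun x =>
       if x == 2 then 1
       else if x <= n - 2 * i + 1 then x + 2 * i - 2
       else x + 2 * i - n).

Definition delta_e (n i : nat) : ptrans n :=
  mk_ptrans n (fun x => x \notin [:: 2; 2 * i + 1; n])
    (fun x =>
       if x == 1 then 2
       else if x <= 2 * i then x + n - 2 * i
       else x + 2 - 2 * i).

Definition eta1 (n : nat) : ptrans n := mk_ptrans n odd (fun x => x + 1).

Definition eta2 (n : nat) : ptrans n :=
  mk_ptrans n (fun x => ~~ odd x) (fun x => x - 1).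

Definition genA (n : nat) : {set ptrans n} :=
  [set sigma1 n; sigma2 n; epsilon n 1; epsilon n n]
  :|: [set gamma n i n | i : 'I_n.+1 & ~~ odd i && (4 <= i <= 2 * (n %/ 4))]
  :|: [set gamma n i 1 | i : 'I_n.+1 & odd i && (5 <= i <= 2 * (n %/ 4) + 1)].

Definition genB (n : nat) : {set ptrans n} :=
  [set delta_o n 1; delta_e n 1; eta1 n; eta2 n]
  :|: [set delta_o n i | i : 'I_n.+1 & 2 <= i <= n %/ 4]
  :|: [set delta_e n i | i : 'I_n.+1 & 2 <= i <= n %/ 4].

Definition genG (n : nat) : {set ptrans n} := genA n :|: genB n.

(* Main.v *)
Require Import Defs.
From mathcomp Require Import all_boot all_fingroup zify.

(** Regard an element [a] of IC_n as a placement of the paths and gaps of its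
domain on the circle, and call a point changed if [a] moves it to a point of the
other parity; a changed point has no neighbour in the domain.  If [a] changes [p]
and some other point of the parity of [p] lies outside the domain, a rotated or
reflected [delta] moves [p] alone to the other parity, which lowers the number of
changed points; the same can be done on the image side.  If neither is possible,
[a] maps one whole parity class to the other, and composing with [eta1] or [eta2]
makes it parity preserving.

The conjugates of the [gamma]s reverse any arc between two undefined points of the
same parity.  For a parity-preserving [a], rotate so that some point is undefined
in both the domain and the image, and cut the circle there.  Arc reversals then
make [a] the identity on longer and longer initial segments: this is the argument
that two Eulerian circuits of a graph (here with two vertices, the parities of the
undefined points, and the paths as edges) differ by reversals of closed subtrails.
An [a] defined everywhere is a symmetry of the crown. *)

(** * Partial maps as functions on labels *)

(* [0], which is not a label, stands for undefined. *)
Definition lab_app {n : nat} (a : ptrans n) (i : nat) : nat :=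
  if i is k.+1 then oapp (fun x => oapp (@label n) 0 (papp a x)) 0 (insub k) else 0.

#[local] Arguments label : simpl never.
#[local] Arguments lab_app : simpl never.

Section PartialMaps.

Context {n : nat}.
Implicit Types (a b : ptrans n) (i j : nat).

Lemma lab_appE a (x : 'I_n) : lab_app a (label x) = oapp (@label n) 0 (papp a x).
Proof. by rewrite /lab_app /label valK. Qed.

Lemma label_onto i : 0 < i <= n -> exists x : 'I_n, label x = i.
Proof. by case: i => // i /= lt_in; exists (Ordinal lt_in). Qed.

Lemma lab_app_out a i : i = 0 \/ n < i -> lab_app a i = 0.
Proof. by case: i => [|k] [//|lt_nk] //; rewrite /lab_app insubF //; lia. Qed.

Lemma lab_app_range a i : lab_app a i <> 0 -> 0 < i <= n /\ 0 < lab_app a i <= n.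
Proof.
move=> ai_neq0; have i_in: 0 < i <= n.
  by case: (posnP i) (leqP i n) => [i0|i_gt0] []// h; case: ai_neq0; apply: lab_app_out; lia.
split=> //; have [x def_i] := label_onto i i_in; move: ai_neq0.
by rewrite -def_i lab_appE; case: (papp a x) => //= y _; rewrite /label ltn_ord.
Qed.

Lemma lab_app_le a i : lab_app a i <= n.
Proof. by have [->|/eqP/lab_app_range] := eqVneq (lab_app a i) 0; lia. Qed.

Lemma lab_appM a b i : lab_app (a * b)%g i = lab_app b (lab_app a i).
Proof.
case: i => // k; rewrite /lab_app -/(lab_app b _); case: insubP => //= x _ _.
by rewrite {1}/papp ffunE /papp; case: (fun_of_fin a x) => //= y; rewrite -lab_appE.
Qed.

Lemma label_inj : injective (@label n).
Proof. by move=> x y [/val_inj]. Qed.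

Lemma lab_app_inj a b : (forall i, lab_app a i = lab_app b i) -> a = b.
Proof.
move=> eq_ab; apply/ffunP=> x; have := eq_ab (label x); rewrite !lab_appE /papp.
by case: (fun_of_fin a x) (fun_of_fin b x) => [y|] [z|] //= /label_inj->.
Qed.

Lemma lab_app_undef (D : pred nat) f i : 0 < i <= n -> ~~ D i -> lab_app (mk_ptrans n D f) i = 0.
Proof.
by case/label_onto=> x <- /negPf nDx; rewrite lab_appE /papp ffunE nDx.
Qed.

(** The bound [2 * n] makes reduction modulo [n] a single optional subtraction; the formulas of all
    generators respect it on their domains. *)
Lemma lab_app_def (D : pred nat) f i : 0 < i <= n -> D i -> 0 < f i <= 2 * n ->
  lab_app (mk_ptrans n D f) i = if f i <= n then f i else f i - n.
Proof.
case/label_onto=> x <- Dx; rewrite lab_appE /papp ffunE Dx /point.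
move: (f (label x)) => m m_in; have n_gt0 : 0 < n by lia.
case: insubP => [u _ /= def_u|]; last by rewrite ltn_mod n_gt0.
rewrite /label def_u {u def_u}.
have [le_mn|lt_nm] := leqP m n.
  rewrite -(_ : m.-1 + n = m + n.-1) ?modnDr; last by lia.
  by rewrite modn_small; lia.
rewrite -(_ : m.-1 - n + n + n = m + n.-1) ?modnDr; last by lia.
by rewrite modn_small; lia.
Qed.

(** * Order preservation and inverses in terms of labels *)

Definition crown_lab (i j : nat) : bool :=
  odd i && [|| j == i.+1, i == j.+1 | (i == 1) && (j == n)].

Definition in_crown a :=
  (forall i j, lab_app a i <> 0 -> lab_app a i = lab_app a j -> i = j) /\
  (forall i j, lab_app a i <> 0 -> lab_app a j <> 0 ->
     crown_lab i j = crown_lab (lab_app a i) (lab_app a j)).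

Lemma ICP a : a \in IC n <-> in_crown a.
Proof.
rewrite inE; split=> [/andP[a_inj a_cr]|[a_inj a_cr]].
  split=> [i j ai_neq0 eq_aij|i j ai_neq0 aj_neq0].
    have aj_neq0: lab_app a j <> 0 by rewrite -eq_aij.
    have [/label_onto[x def_i] _] := lab_app_range a i ai_neq0.
    have [/label_onto[y def_j] _] := lab_app_range a j aj_neq0.
    move: ai_neq0 aj_neq0 eq_aij; rewrite -def_i -def_j !lab_appE => ax ay eq_a.
    have a_xy: papp a x = papp a y.
      by case: (papp a x) (papp a y) ax ay eq_a => [u|] [v|] //= _ _ /label_inj->.
    move: a_inj; rewrite inE => /forall_inP/(_ x).
    rewrite inE; have -> : papp a x by case: (papp a x) ax.
    move/(_ isT)/forall_inP/(_ y); rewrite inE a_xy eqxx.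
    have -> : papp a y by case: (papp a y) ay.
    by move/(_ isT)/eqP->.
  have [/label_onto[x def_i] _] := lab_app_range a i ai_neq0.
  have [/label_onto[y def_j] _] := lab_app_range a j aj_neq0.
  move: ai_neq0 aj_neq0; rewrite -def_i -def_j !lab_appE.
  case def_x: (papp a x) => [u|] //; case def_y: (papp a y) => [v|] //= _ _.
  move/forallP/(_ x)/forallP/(_ y)/forallP/(_ u)/forallP/(_ v): a_cr.
  by rewrite def_x def_y !eqxx => /eqP.
apply/andP; split.
  rewrite inE; apply/forall_inP=> x; rewrite inE => ax; apply/forall_inP=> y _.
  apply/implyP=> /eqP eq_a; apply/eqP/label_inj/a_inj; rewrite !lab_appE ?eq_a //.
  by move: ax; rewrite eq_a; case: (papp a y).
apply/forallP=> x; apply/forallP=> y; apply/forallP=> u; apply/forallP=> v.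
apply/implyP=> /eqP ax; apply/implyP=> /eqP ay; apply/eqP.
by have := a_cr (label x) (label y); rewrite !lab_appE ax ay; apply.
Qed.

Lemma in_crownM a b : in_crown a -> in_crown b -> in_crown (a * b)%g.
Proof.
move=> [a_inj a_cr] [b_inj b_cr].
have a_neq0 i : lab_app b (lab_app a i) <> 0 -> lab_app a i <> 0.
  by move=> bai /= ai0; rewrite ai0 in bai.
split=> [i j|i j]; rewrite !lab_appM => bai.
  by move/(b_inj _ _ bai)/a_inj; apply; apply: a_neq0.
move=> baj; apply: etrans (b_cr _ _ bai baj).
by apply: a_cr; apply: a_neq0.
Qed.

(** Inverses in the sense of inverse semigroups: the domain of each map is the image of the other.
    Hence, for a label [x], [lab_app b x = 0] says that [x] is missing from the image of [a]; holes
    of the image are always expressed this way. *)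
Definition mutual_inverse a b :=
  (forall i, lab_app a i <> 0 -> lab_app b (lab_app a i) = i) /\
  (forall i, lab_app b i <> 0 -> lab_app a (lab_app b i) = i).

Lemma mutual_inverse_sym a b : mutual_inverse a b -> mutual_inverse b a.
Proof. by case. Qed.

Lemma mutual_inverseM a b c d : mutual_inverse a b -> mutual_inverse c d ->
  mutual_inverse (a * c)%g (d * b)%g.
Proof.
move=> [aK bK] [cK dK]; split=> i; rewrite !lab_appM => i_neq0.
  by rewrite cK // aK // => ai0; rewrite ai0 in i_neq0.
by rewrite bK // dK // => di0; rewrite di0 in i_neq0.
Qed.

Lemma mutual_inverse_ex a : in_crown a -> exists2 b, mutual_inverse a b & in_crown b.
Proof.
case=> a_inj a_cr.
pose b : ptrans n := [ffun y => [pick x | papp a x == Some y]].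
have ab: mutual_inverse a b.
  split=> i i_neq0.
    have [/label_onto[x def_i] _] := lab_app_range a i i_neq0.
    rewrite -def_i in i_neq0 *.
    move: (i_neq0); rewrite lab_appE; case def_ax: (papp a x) => [y|] //= _.
    rewrite lab_appE /papp ffunE; case: pickP => [z /eqP def_az|/(_ x)]; last by rewrite def_ax eqxx.
    by apply: a_inj; rewrite !lab_appE def_az ?def_ax.
  have [/label_onto[y def_i] _] := lab_app_range b i i_neq0.
  move: i_neq0; rewrite -def_i lab_appE /papp ffunE; case: pickP => //= x /eqP def_ax _.
  by rewrite lab_appE def_ax.
exists b => //; case: ab => aK bK; split=> [i j bi eq_b|i j bi bj].
  by rewrite -(bK i) // eq_b bK // -eq_b.
have b_neq0 k : lab_app b k <> 0 -> lab_app a (lab_app b k) <> 0.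
  by move=> bk; rewrite bK // => k0; rewrite k0 lab_app_out in bk; auto.
by have := a_cr _ _ (b_neq0 i bi) (b_neq0 j bj); rewrite !bK.
Qed.

End PartialMaps.
Arguments crown_lab : clear implicits.

(** * Generated subsemigroups *)

Lemma sgen_sub n (A : {set ptrans n}) : A \subset sgen A.
Proof. by apply/bigcapsP=> S /andP[]. Qed.

Lemma sgenM n (A : {set ptrans n}) a b :
  a \in sgen A -> b \in sgen A -> (a * b)%g \in sgen A.
Proof.
move=> /bigcapP Sa /bigcapP Sb; apply/bigcapP=> S ok_S; have /andP[_ SM] := ok_S.
by move/forall_inP/(_ a (Sa S ok_S))/forall_inP/(_ b (Sb S ok_S)): SM.
Qed.

Lemma sgen_min n (A S : {set ptrans n}) : A \subset S ->
  (forall a b, a \in S -> b \in S -> (a * b)%g \in S) -> sgen A \subset S.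
Proof.
move=> sAS SM; apply: bigcap_inf; rewrite sAS /=.
by apply/forall_inP=> a Sa; apply/forall_inP=> b Sb; apply: SM.
Qed.

(* Case analysis guided by the disjunctions of the context, pruned at every step:
   calling [lia] on all the disjunctions at once yields certificates whose size is
   the product of the numbers of alternatives. *)
Ltac lia_no_neq :=
  repeat match goal with H : _ <> _ |- _ => clear H end; lia.

Ltac absurd_lia := exfalso;
  repeat match goal with
    | H : _ \/ _ |- _ => clear H
    | H : _ -> _ |- _ => clear H
    end;
  first [lia_no_neq
    | match goal with H : _ <> _ |- _ => apply: H; lia_no_neq end].

Ltac goal_lia := match goal with
  | |- _ /\ _ => split; goal_lia
  | |- _ \/ _ => first [left; goal_lia | right; goal_lia]
  | |- _ => first [lia_no_neq | absurd_lia | lia]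
  end.

Ltac split_conj := repeat match goal with H : _ /\ _ |- _ => destruct H end.

Ltac cases_lia := split_conj; match goal with
  | H : _ \/ _ |- _ => destruct H as [H|H]; split_conj; first [absurd_lia | cases_lia]
  | |- _ => goal_lia
  end.

(** * The generators *)

Section Crown.

Context (n : nat) (n_ge4 : 4 <= n) (n_even : ~~ odd n).

Local Notation S := (sgen (genG n)).

(** A disjunction of linear constraints suits [lia]. The last alternative, a formula out of the
    range of one reduction, is refuted separately for each generator. *)
Lemma mk_ptrans_spec (D : pred nat) f i : 0 < i <= n ->
  ~~ D i /\ lab_app (mk_ptrans n D f) i = 0 \/
  D i /\ (0 < f i <= n /\ lab_app (mk_ptrans n D f) i = f i \/
             n < f i <= 2 * n /\ lab_app (mk_ptrans n D f) i + n = f i \/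
             f i = 0 \/ 2 * n < f i).
Proof.
move=> i_in; have [Di|nDi] := boolP (D i); last by left; rewrite lab_app_undef.
right; split=> //; have [f0|f_gt0] := posnP (f i); first lia.
have [f_big|f_le] := ltnP (2 * n) (f i); first lia.
rewrite lab_app_def //; last lia.
by case: ifP; lia.
Qed.

Lemma sigma1E i : 0 < i <= n ->
  i + 2 <= n /\ lab_app (sigma1 n) i = i + 2 \/
  n < i + 2 /\ lab_app (sigma1 n) i + n = i + 2.
Proof.
move=> i_in; have := mk_ptrans_spec predT (fun x => x + 2) i i_in.
rewrite -/(sigma1 n) /=; lia.
Qed.

Lemma sigma2E i : 0 < i <= n ->
  i = 1 /\ lab_app (sigma2 n) i = 1 \/ 1 < i /\ lab_app (sigma2 n) i + i = n + 2.
Proof.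
move=> i_in.
have := mk_ptrans_spec predT (fun x => if x == 1 then 1 else n + 2 - x) i i_in.
rewrite -/(sigma2 n) /=; case: eqP; lia.
Qed.

Lemma epsilonE e i : 0 < i <= n ->
  i = e /\ lab_app (epsilon n e) i = 0 \/ i <> e /\ lab_app (epsilon n e) i = i.
Proof.
move=> i_in; have := mk_ptrans_spec (fun x => x != e) id i i_in.
rewrite -/(epsilon n e) /=; lia.
Qed.

Lemma eta1E i : 0 < i <= n ->
  ~~ odd i /\ lab_app (eta1 n) i = 0 \/ odd i /\ lab_app (eta1 n) i = i + 1.
Proof.
move=> i_in; have := mk_ptrans_spec odd (fun x => x + 1) i i_in.
rewrite -/(eta1 n) /=; lia.
Qed.

Lemma eta2E i : 0 < i <= n ->
  odd i /\ lab_app (eta2 n) i = 0 \/ ~~ odd i /\ lab_app (eta2 n) i + 1 = i.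
Proof.
move=> i_in; have := mk_ptrans_spec (fun x => ~~ odd x) (fun x => x - 1) i i_in.
rewrite -/(eta2 n) /=; lia.
Qed.

Lemma gamma_nE e i : 0 < e < n -> 0 < i <= n ->
  (i = e \/ i = n) /\ lab_app (gamma n e n) i = 0 \/
  i < e /\ lab_app (gamma n e n) i = i \/
  e < i < n /\ lab_app (gamma n e n) i + i = e + n.
Proof.
move=> e_in i_in.
have := mk_ptrans_spec (fun x => x \notin [:: e; n])
 (fun x => if e < n then (if e < x < n then e + n - x else x)
       else (if n < x < e then x else e + n + n - x)) i i_in.
rewrite -/(gamma n e n) /= !inE; do !case: ifP; move=> *; cases_lia.
Qed.

Lemma gamma_1E e i : 1 < e <= n -> 0 < i <= n ->
  (i = e \/ i = 1) /\ lab_app (gamma n e 1) i = 0 \/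
  1 < i < e /\ lab_app (gamma n e 1) i = i \/
  e < i /\ lab_app (gamma n e 1) i + i = e + 1 + n.
Proof.
move=> e_in i_in.
have := mk_ptrans_spec (fun x => x \notin [:: e; 1])
 (fun x => if e < 1 then (if e < x < 1 then e + 1 - x else x)
       else (if 1 < x < e then x else e + 1 + n - x)) i i_in.
rewrite -/(gamma n e 1) /= !inE; do !case: ifP; move=> *; cases_lia.
Qed.

Lemma delta_oE k i : 0 < k -> 2 * k <= n - 2 -> 0 < i <= n ->
  (i = 1 \/ i = 3 \/ i + 2 * k = n + 2) /\ lab_app (delta_o n k) i = 0 \/
  i = 2 /\ lab_app (delta_o n k) i = 1 \/
  4 <= i /\ i + 2 * k <= n + 1 /\ lab_app (delta_o n k) i + 2 = i + 2 * k \/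
  n + 3 <= i + 2 * k /\ lab_app (delta_o n k) i + n = i + 2 * k.
Proof.
move=> k_gt0 k_le i_in.
have := mk_ptrans_spec (fun x => x \notin [:: 1; 3; n - 2 * k + 2])
    (fun x =>
       if x == 2 then 1
       else if x <= n - 2 * k + 1 then x + 2 * k - 2
       else x + 2 * k - n) i i_in.
rewrite -/(delta_o n k) /= !inE; do !case: ifP; move=> *; cases_lia.
Qed.

Lemma delta_eE k i : 0 < k -> 2 * k <= n - 2 -> 0 < i <= n ->
  (i = 2 \/ i = 2 * k + 1 \/ i = n) /\ lab_app (delta_e n k) i = 0 \/
  i = 1 /\ lab_app (delta_e n k) i = 2 \/
  3 <= i <= 2 * k /\ lab_app (delta_e n k) i + 2 * k = i + n \/
  2 * k + 2 <= i < n /\ lab_app (delta_e n k) i + 2 * k = i + 2.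
Proof.
move=> k_gt0 k_le i_in.
have := mk_ptrans_spec (fun x => x \notin [:: 2; 2 * k + 1; n])
    (fun x =>
       if x == 1 then 2
       else if x <= 2 * k then x + n - 2 * k
       else x + 2 - 2 * k) i i_in.
rewrite -/(delta_e n k) /= !inE; do !case: ifP; move=> *; cases_lia.
Qed.

(** As [n >= 4] gives [1 <= n %/ 4], the separately listed [delta_o n 1] and [delta_e n 1] join
    their families here. *)
Lemma genG_ind (P : ptrans n -> Prop) :
  P (sigma1 n) -> P (sigma2 n) -> P (epsilon n 1) -> P (epsilon n n) ->
  (forall e, ~~ odd e -> 4 <= e <= 2 * (n %/ 4) -> P (gamma n e n)) ->
  (forall e, odd e -> 5 <= e <= 2 * (n %/ 4) + 1 -> P (gamma n e 1)) ->
  (forall k, 1 <= k <= n %/ 4 -> P (delta_o n k)) ->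
  (forall k, 1 <= k <= n %/ 4 -> P (delta_e n k)) ->
  P (eta1 n) -> P (eta2 n) -> forall a, a \in genG n -> P a.
Proof.
move=> Ps1 Ps2 Pe1 Pen Pg0 Pg1 Pdo Pde Ph1 Ph2 a; rewrite !inE -!orbA.
case/or4P=> [/eqP->|/eqP->|/eqP->|] //; case/or4P=> [/eqP->||| ] //.
- by case/imsetP=> e; rewrite inE => /andP[e_even e_in] ->; apply: Pg0.
- by case/imsetP=> e; rewrite inE => /andP[e_odd e_in] ->; apply: Pg1.
case/or4P=> [/eqP->|/eqP->|/eqP->|] //; try (by apply: Pdo; lia); try (by apply: Pde; lia).
case/or3P=> [/eqP->||] //.
- by case/imsetP=> k; rewrite inE => k_in ->; apply: Pdo; lia.
by case/imsetP=> k; rewrite inE => k_in ->; apply: Pde; lia.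
Qed.

Lemma genG_sigma1 : sigma1 n \in genG n. Proof. by rewrite !inE eqxx. Qed.
Lemma genG_sigma2 : sigma2 n \in genG n. Proof. by rewrite !inE eqxx !orbT. Qed.
Lemma genG_epsilon1 : epsilon n 1 \in genG n. Proof. by rewrite !inE eqxx !orbT. Qed.
Lemma genG_epsilonn : epsilon n n \in genG n. Proof. by rewrite !inE eqxx !orbT. Qed.
Lemma genG_eta1 : eta1 n \in genG n. Proof. by rewrite !inE eqxx !orbT. Qed.
Lemma genG_eta2 : eta2 n \in genG n. Proof. by rewrite !inE eqxx !orbT. Qed.

Lemma genG_gamma_n e : ~~ odd e -> 4 <= e <= 2 * (n %/ 4) -> gamma n e n \in genG n.
Proof.
move=> e_even e_in; apply/setUP; left; apply/setUP; left; apply/setUP; right.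
have lt_en: e < n.+1 by lia.
by apply/imsetP; exists (Ordinal lt_en) => //; rewrite inE /= e_even.
Qed.

Lemma genG_gamma_1 e : odd e -> 5 <= e <= 2 * (n %/ 4) + 1 -> gamma n e 1 \in genG n.
Proof.
move=> e_odd e_in; apply/setUP; left; apply/setUP; right.
have lt_en: e < n.+1 by lia.
by apply/imsetP; exists (Ordinal lt_en) => //; rewrite inE /= e_odd.
Qed.

Lemma genG_delta_o k : 1 <= k <= n %/ 4 -> delta_o n k \in genG n.
Proof.
move=> k_in; apply/setUP; right; apply/setUP; left; apply/setUP.
have [k_gt1|k_le1] := ltnP 1 k; [right|left].
  have lt_kn: k < n.+1 by lia.
  by apply/imsetP; exists (Ordinal lt_kn) => //; rewrite inE /=; lia.
by rewrite (_ : k = 1) ?inE ?eqxx //; lia.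
Qed.

Lemma genG_delta_e k : 1 <= k <= n %/ 4 -> delta_e n k \in genG n.
Proof.
move=> k_in; apply/setUP; right; apply/setUP.
have [k_gt1|k_le1] := ltnP 1 k; [right|left].
  have lt_kn: k < n.+1 by lia.
  by apply/imsetP; exists (Ordinal lt_kn) => //; rewrite inE /=; lia.
by apply/setUP; left; rewrite (_ : k = 1) ?inE ?eqxx ?orbT //; lia.
Qed.

(** * The generators preserve and reflect the order *)

Definition adjacent (i j : nat) :=
  j = i.+1 \/ i = j.+1 \/ i = 1 /\ j = n \/ i = n /\ j = 1.

Lemma crown_labP i j : crown_lab n i j <-> odd i /\ adjacent i j.
Proof. by rewrite /crown_lab /adjacent; case: (boolP (odd i)) => i_odd; lia. Qed.

(** The crown order is adjacency on the circle together with oddness of the first point, so it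
    suffices that adjacency be preserved and reflected, with the parity of the first point kept
    whenever it occurs. *)
Lemma in_crown_intro (a : ptrans n) :
  (forall i j u v, 0 < i <= n -> 0 < j <= n -> 0 < u <= n -> 0 < v <= n ->
     lab_app a i = u -> lab_app a j = v ->
     (u = v -> i = j) /\
     (adjacent i j -> odd u = odd i /\ adjacent u v) /\
     (adjacent u v -> odd u = odd i /\ adjacent i j)) ->
  in_crown a.
Proof.
move=> aP; split=> i j ai.
  move=> eq_a; have aj : lab_app a j <> 0 by rewrite -eq_a.
  have [i_in ai_in] := lab_app_range a i ai; have [j_in aj_in] := lab_app_range a j aj.
  by have [] := aP i j _ _ i_in j_in ai_in aj_in erefl erefl; auto.
move=> aj; have [i_in ai_in] := lab_app_range a i ai.
have [j_in aj_in] := lab_app_range a j aj.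
have [_ [h1 h2]] := aP i j _ _ i_in j_in ai_in aj_in erefl erefl.
apply/idP/idP; rewrite !crown_labP => -[i_odd adj].
  by have [->] := h1 adj.
by have [<-] := h2 adj.
Qed.

Ltac in_crown_cases := rewrite /adjacent; repeat split=> *; cases_lia.

Lemma genG_in_crown a : a \in genG n -> in_crown a.
Proof.
have n_half : n = 2 * n./2 by lia.
move: a; apply: genG_ind.
- apply: in_crown_intro => i j u v i_in j_in u_in v_in au av.
  have := sigma1E j j_in; have := sigma1E i i_in.
  rewrite {}au {}av => uE vE; clear n_even.
  (* Parities are settled first, from one value alone; what remains is linear arithmetic without
     [odd]. *)
  have u_odd : odd u = odd i by clear vE; cases_lia.
  clear n_half; rewrite u_odd; in_crown_cases.
- apply: in_crown_intro => i j u v i_in j_in u_in v_in au av.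
  have := sigma2E j j_in; have := sigma2E i i_in.
  rewrite {}au {}av => uE vE; clear n_even.
  have u_odd : odd u = odd i by clear vE; cases_lia.
  clear n_half; rewrite u_odd; in_crown_cases.
- apply: in_crown_intro => i j u v i_in j_in u_in v_in au av.
  have := epsilonE 1 j j_in; have := epsilonE 1 i i_in.
  rewrite {}au {}av => uE vE; clear n_even.
  have u_odd : odd u = odd i by clear vE; cases_lia.
  clear n_half; rewrite u_odd; in_crown_cases.
- apply: in_crown_intro => i j u v i_in j_in u_in v_in au av.
  have := epsilonE n j j_in; have := epsilonE n i i_in.
  rewrite {}au {}av => uE vE; clear n_even.
  have u_odd : odd u = odd i by clear vE; cases_lia.
  clear n_half; rewrite u_odd; in_crown_cases.
- move=> e e_even e_in; have e_lt : 0 < e < n by lia.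
  apply: in_crown_intro => i j u v i_in j_in u_in v_in au av.
  have := gamma_nE e j e_lt j_in; have := gamma_nE e i e_lt i_in.
  rewrite {}au {}av => uE vE; clear n_even.
  clear e_in; have u_odd : odd u = odd i by clear vE; cases_lia.
  clear n_half e_even; rewrite u_odd; in_crown_cases.
- move=> e e_odd e_in; have e_lt : 1 < e <= n by lia.
  apply: in_crown_intro => i j u v i_in j_in u_in v_in au av.
  have := gamma_1E e j e_lt j_in; have := gamma_1E e i e_lt i_in.
  rewrite {}au {}av => uE vE; clear n_even.
  clear e_in; have u_odd : odd u = odd i by clear vE; cases_lia.
  clear n_half e_odd; rewrite u_odd; in_crown_cases.
- move=> k k_in; have [k_gt0 k_le] : 0 < k /\ 2 * k <= n - 2 by lia.
  apply: in_crown_intro => i j u v i_in j_in u_in v_in au av.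
  have := delta_oE k j k_gt0 k_le j_in; have := delta_oE k i k_gt0 k_le i_in.
  rewrite {}au {}av => uE vE; clear n_even.
  (* The point 2 alone changes parity. Its neighbours 1 and 3 are outside the domain, and the
     neighbours 2 and [n] of its image 1 are outside the image, so it enters no adjacency. *)
  clear k_in; have u_odd : i = 2 \/ odd u = odd i by clear vE; cases_lia.
  clear n_half; in_crown_cases.
- move=> k k_in; have [k_gt0 k_le] : 0 < k /\ 2 * k <= n - 2 by lia.
  apply: in_crown_intro => i j u v i_in j_in u_in v_in au av.
  have := delta_eE k j k_gt0 k_le j_in; have := delta_eE k i k_gt0 k_le i_in.
  rewrite {}au {}av => uE vE; clear n_even.
  clear k_in; have u_odd : i = 1 \/ odd u = odd i by clear vE; cases_lia.
  clear n_half; in_crown_cases.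
- apply: in_crown_intro => i j u v i_in j_in u_in v_in au av.
  have := eta1E j j_in; have := eta1E i i_in.
  rewrite {}au {}av => uE vE; clear n_even.
  in_crown_cases.
- apply: in_crown_intro => i j u v i_in j_in u_in v_in au av.
  have := eta2E j j_in; have := eta2E i i_in.
  rewrite {}au {}av => uE vE; clear n_even.
  in_crown_cases.
Qed.

Lemma sgen_in_crown a : a \in sgen (genG n) -> in_crown a.
Proof.
move: a; suff /subsetP sS_IC : S \subset IC n by move=> a /sS_IC/ICP.
apply: sgen_min; first by apply/subsetP=> a /genG_in_crown/ICP.
by move=> a b /ICP ca /ICP cb; apply/ICP/in_crownM.
Qed.

(** * Symmetries and reversals of arcs *)

Lemma sgen_gen a : a \in genG n -> a \in S.
Proof. exact/subsetP/sgen_sub. Qed.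

Lemma rotation d : ~~ odd d -> d <= n ->
  exists2 g, g \in S & forall i, 0 < i <= n ->
    lab_app g i = i + d /\ i + d <= n \/ lab_app g i + n = i + d /\ n < i + d.
Proof.
move=> d_even; rewrite -(even_halfK d_even).
elim: d./2 => {d d_even} [_|d IHd d_le].
  (* [sgen] provides products only, so the identity is obtained as the square of the involution
     [sigma2]. *)
  have s2S := sgen_gen _ genG_sigma2.
  exists (sigma2 n * sigma2 n)%g => [|i i_in]; first exact: sgenM.
  have := sigma2E i i_in; have := @lab_app_le n (sigma2 n) i.
  rewrite lab_appM; move: (lab_app _ i) => j j_le jE.
  by have := sigma2E j; lia.
have [|g gS gE] := IHd; first lia.
exists (g * sigma1 n)%g => [|i i_in].
  exact: sgenM gS (sgen_gen _ genG_sigma1).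
have := gE i i_in; have := lab_app_le g i.
rewrite lab_appM; move: (lab_app _ i) => j j_le jE.
by have := sigma1E j; lia.
Qed.

(** Modulo [n], [sigma2] sends [i] to [2 - i]; the rotation by [c - 2] turns this into [c - i]. *)
Lemma reflection c : ~~ odd c -> 2 <= c <= n ->
  exists2 g, g \in S & forall i, 0 < i <= n ->
    0 < lab_app g i <= n /\ (lab_app g i + i = c \/ lab_app g i + i = c + n).
Proof.
move=> c_even c_in; have [||g gS gE] := rotation (c - 2); [lia|lia|].
exists (sigma2 n * g)%g => [|i i_in].
  exact: sgenM (sgen_gen _ genG_sigma2) gS.
have := sigma2E i i_in; have := @lab_app_le n (sigma2 n) i.
rewrite lab_appM; move: (lab_app _ i) => j j_le jE.
by have := gE j; lia.
Qed.

(** * Partial identities *)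

Lemma sgen_epsilon e : 0 < e <= n -> epsilon n e \in S.
Proof.
move=> e_in.
(* Rotations keep parity, so [epsilon n e] is conjugate to whichever of [epsilon n 1] and
   [epsilon n n] has the parity of [e]. *)
have [e0 [e0S e0_in e0_odd e0_le]] : exists e0,
    [/\ epsilon n e0 \in S, 0 < e0 <= n, odd e0 = odd e & e0 = 1 \/ e0 = n].
  have [e_odd|e_even] := boolP (odd e).
    by exists 1; split; auto; [apply/sgen_gen/genG_epsilon1 | lia].
  by exists n; split; auto; [apply/sgen_gen/genG_epsilonn | lia | lia].
pose d := if e0 <= e then e - e0 else e + n - e0.
have d_ok : ~~ odd d /\ d <= n /\ (e = e0 + d \/ e + n = e0 + d).
  by rewrite /d; case: ifP; lia.
have [||g gS gE] := rotation d; [lia|lia|].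
have [||h hS hE] := rotation (n - d); [lia|lia|].
suff -> : epsilon n e = (h * epsilon n e0 * g)%g by do 2!apply: sgenM => //.
apply: lab_app_inj => i; have [i_in|i_out] := boolP (0 < i <= n); last first.
  by rewrite !lab_app_out //; lia.
clearbody d; case: d_ok => _ [d_le d_def]; clear e0_odd; rewrite !lab_appM.
have u_in := @lab_app_le n h i; have := hE i i_in; have := epsilonE e i i_in.
move: (lab_app (epsilon n e) i) (lab_app h i) u_in => v u u_le vE uE.
have u_in : 0 < u <= n by lia.
have [[ue ->]|[ue ->]] := epsilonE e0 u u_in.
  by rewrite lab_app_out; lia.
by have := gE u u_in; lia.
Qed.

Lemma pidE (E : pred nat) i : 0 < i <= n ->
  lab_app (mk_ptrans n E id) i = if E i then i else 0.
Proof. by move=> i_in; have := mk_ptrans_spec E id i i_in; case: ifP; lia. Qed.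

Lemma sgen_pid (D : pred nat) : mk_ptrans n D id \in S.
Proof.
have eq_pid E F : (forall i, 0 < i <= n -> E i = F i) ->
    mk_ptrans n E id = mk_ptrans n F id.
  move=> eqEF; apply: lab_app_inj => i.
  have [i_in|i_out] := boolP (0 < i <= n); last by rewrite !lab_app_out //; lia.
  by rewrite !pidE // eqEF.
(* The points outside [D] are deleted one at a time, in increasing order. *)
suff pidS k : k <= n -> mk_ptrans n (fun i => D i || (k < i)) id \in S.
  by rewrite (eq_pid _ (fun i => D i || (n < i))) ?pidS // => i i_in; lia.
elim: k => [_|k IHk k_lt].
  have [||g gS gE] := rotation 0; [lia|lia|].
  suff <- : g = mk_ptrans n (fun i => D i || (0 < i)) id by [].
  apply: lab_app_inj => i.
  have [i_in|i_out] := boolP (0 < i <= n); last by rewrite !lab_app_out //; lia.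
  by rewrite pidE //; have := gE i i_in; case: ifP; lia.
have [Dk|nDk] := boolP (D k.+1).
  rewrite (eq_pid _ (fun i => D i || (k < i))); first by apply: IHk; lia.
  by move=> i i_in; have [->|] := eqVneq i k.+1; [rewrite Dk | lia].
suff -> : mk_ptrans n (fun i => D i || (k.+1 < i)) id =
    (mk_ptrans n (fun i => D i || (k < i)) id * epsilon n k.+1)%g.
  by apply: sgenM; [apply: IHk; lia | apply: sgen_epsilon; lia].
apply: lab_app_inj => i.
have [i_in|i_out] := boolP (0 < i <= n); last by rewrite !lab_app_out //; lia.
rewrite lab_appM (pidE (fun i => D i || (k < i))) // (pidE (fun i => D i || (k.+1 < i))) //.
have [->|ne_ik] := eqVneq i k.+1.
  by rewrite (negPf nDk) ltnn ltnSn /=; have := epsilonE k.+1 k.+1; lia.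
have -> : (k.+1 < i) = (k < i) by lia.
case: ifP => _; last by rewrite lab_app_out; lia.
by have := epsilonE k.+1 i i_in; lia.
Qed.

Lemma sgen_partial_identity a :
  (forall i, lab_app a i <> 0 -> lab_app a i = i) -> a \in S.
Proof.
move=> a_id; suff -> : a = mk_ptrans n (fun i => lab_app a i != 0) id by apply: sgen_pid.
apply: lab_app_inj => i.
have [i_in|i_out] := boolP (0 < i <= n); last by rewrite !lab_app_out //; lia.
by rewrite pidE //; have := a_id i; case: ifP; lia.
Qed.

(** A uniform reading of the two families: the arc of length [e] ending at [p] is fixed and the
    complementary arc of length [m] is reversed. The other end is both [p + m] and [p - e], only one
    of which is a label. *)
Lemma sgen_gen_gamma e m p : e + m = n -> ~~ odd e -> 4 <= e <= 2 * (n %/ 4) ->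
    p = e \/ p = e + 1 ->
  exists2 g, g \in S & forall i, 0 < i <= n ->
    (i = p \/ i = p + m \/ i + e = p) /\ lab_app g i = 0 \/
    i <> p /\ i <> p + m /\ i + e <> p /\
      (i < p /\ lab_app g i = i \/ p < i /\ lab_app g i + i = 2 * p + m).
Proof.
move=> def_m e_even e_in p_e; have m_gt0 : 0 < m by lia.
have [e_p|p_e1] := eqVneq p e.
  exists (gamma n e n); first exact/sgen_gen/genG_gamma_n.
  move=> i i_in; have e_gt : 0 < e < n by lia.
  by have gE := gamma_nE e i e_gt i_in; clear n_even e_even e_in; cases_lia.
exists (gamma n p 1); first by apply/sgen_gen/genG_gamma_1; lia.
move=> i i_in; have e_gt : 1 < p <= n by lia.
by have gE := gamma_1E p i e_gt i_in; clear n_even e_even e_in; cases_lia.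
Qed.

(** One of [e] and [e + 1] has the parity of [p], so a rotation conjugates one of the generating
    reversals to the wanted position. *)
Lemma arc_flip e m p : e + m = n -> ~~ odd e -> 4 <= e <= 2 * (n %/ 4) -> 0 < p <= n ->
  exists2 g, g \in S & forall i, 0 < i <= n ->
    (i = p \/ i = p + m \/ i + e = p) /\ lab_app g i = 0 \/
    i <> p /\ i <> p + m /\ i + e <> p /\
      ((p < i < p + m \/ i + e < p) /\ 0 < lab_app g i <= n /\
         (lab_app g i + i = 2 * p + m \/ lab_app g i + i + e = 2 * p \/
          lab_app g i + i + e + n = 2 * p) \/
       (p + m < i \/ i < p < i + e) /\ lab_app g i = i).
Proof.
move=> def_m e_even e_in p_in.
have [q q_e pq_odd] : exists2 q, q = e \/ q = e + 1 & odd q = odd p.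
  by have [odd_p|even_p] := boolP (odd p); [exists (e + 1) | exists e]; lia.
have [g0 g0S g0E] := sgen_gen_gamma e m q def_m e_even e_in q_e.
have [d [d' [d_even d'_even d_n d_def]]] : exists d d',
    [/\ ~~ odd d, ~~ odd d', d + d' = n & p = q + d \/ p + n = q + d].
  have [le_qp|lt_pq] := leqP q p.
    by exists (p - q), (n - (p - q)); split; lia.
  by exists (p + n - q), (q - p); split; lia.
have [||g gS gE] := rotation d; [lia|lia|].
have [||h hS hE] := rotation d'; [lia|lia|].
exists (h * g0 * g)%g => [|i i_in]; first by do 2!apply: sgenM => //.
have {e_in} e_le : 4 <= e <= n by lia.
have {q_e} q_in : e <= q <= e + 1 by clear - q_e; lia.
clear e_even d_even d'_even pq_odd; rewrite !lab_appM.
have := hE i i_in; move: (lab_app h i) => u uE.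
have u_in : 0 < u <= n by clear gE hE g0E; cases_lia.
have := g0E u u_in; move: (lab_app g0 u) => v vE.
have [v0|v_gt0] := posnP v.
  rewrite v0 lab_app_out; auto; left; split=> //.
  by clear gE hE g0E n_even n_ge4; cases_lia.
have v_in : 0 < v <= n by clear gE hE g0E uE; cases_lia.
have := gE v v_in; move: (lab_app g v) => w wE.
clear gE hE g0E n_even n_ge4; right; cases_lia.
Qed.

(** Nothing is claimed at the ends of the arc. An end may be 0 or [n + 1], standing for the labels
    [n] and 1; this is the reason for the last two exclusions. *)
Lemma flip_core a b : a < b <= a + n -> b <= n + 1 -> odd a = odd b ->
  exists2 g, g \in S & forall i, 0 < i <= n ->
    i <> a -> i <> b -> i + n <> b -> 0 < a \/ i <> n ->
    a < i < b /\ lab_app g i + i = a + b \/ (i < a \/ b < i) /\ lab_app g i = i.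
Proof.
move=> ab_lt b_le ab_odd.
have [c [c_even c_in c_def]] : exists c,
    [/\ ~~ odd c, 2 <= c <= n & c = a + b \/ c + n = a + b].
  have [le_abn|lt_nab] := leqP (a + b) n; first by exists (a + b); split; lia.
  by exists (a + b - n); split; lia.
have [||r rS rE] := reflection c; [lia|lia|].
(* An arc with at most one inner point is its own reversal, and the identity serves. *)
have [b_a|d_gt2] := leqP b (a + 2).
  have b_def : b = a + 2 by lia.
  have [||g gS gE] := rotation 0; [by []|by []|exists g => // i i_in ia ib ibn _].
  have giE := gE i i_in; clear - giE i_in ia ib ibn b_def.
  by have [i_a|i_a] := ltnP a i; have [i_b|i_b] := ltnP i b; cases_lia.
(* At most one point is left outside the arc and its ends, and the reflection [a + b - i] fixes
   it. *)
have [b_an|d_ltn] := leqP (a + n - 2) b.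
  have b_def : b = a + n \/ b + 2 = a + n by lia.
  exists r => // i i_in ia ib ibn i0; have riE := rE i i_in.
  clear - riE i_in ia ib ibn i0 b_def c_def c_in b_le ab_lt.
  by have [i_a|i_a] := ltnP a i; have [i_b|i_b] := ltnP i b; cases_lia.
(* One of the complementary lengths [d] and [d'] is at most [2 * (n %/ 4)], as required of the fixed
   arc in [arc_flip]. If it is [d'], the arc is reversed directly; if it is [d], the complement is
   reversed and the reflection then restores it while reversing the arc. *)
pose d := b - a; pose d' := n - d.
have d_n : d + d' = n by rewrite /d' /d; lia.
have d_even : ~~ odd d by rewrite /d; lia.
have b_def : b = a + d by rewrite /d; lia.
have [d_le|d_gt] := leqP d' (2 * (n %/ 4)).
  pose p := if a == 0 then n else a.
  have p_def : a = 0 /\ p = n \/ a = p /\ 0 < p by rewrite /p; case: eqP; lia.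
  have d'_even : ~~ odd d' by clearbody d d'; clear - d_n d_even n_even; lia.
  have d'_in : 4 <= d' <= 2 * (n %/ 4) by rewrite d_le andbT; clear ab_odd d_even c_even; clearbody d d'; lia.
  have p_in : 0 < p <= n by clearbody p; clear - p_def ab_lt b_le d_gt2; cases_lia.
  have d'_d : d' + d = n by rewrite addnC.
  have [g gS gE] := arc_flip d' d p d'_d d'_even d'_in p_in.
  exists g => // i i_in ia ib ibn i0; have giE := gE i i_in; have gi_le := @lab_app_le n g i.
  clearbody p d d'; clear - giE gi_le b_def d_n p_def i_in b_le ia ib ibn i0.
  by have [i_a|i_a] := ltnP a i; have [i_b|i_b] := ltnP i b; cases_lia.
have [q q_in q_def] : exists2 q, 0 < q <= n & b = q \/ b = n + 1 /\ q = 1.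
  by have [b1|b_le'] := eqVneq b (n + 1); [exists 1 | exists b]; lia.
have d_in : 4 <= d <= 2 * (n %/ 4) by clear ab_odd c_even; clearbody d d'; lia.
have [g gS gE] := arc_flip d d' q d_n d_even d_in q_in.
exists (g * r)%g => [|i i_in]; first exact: sgenM.
rewrite lab_appM => ia ib ibn i0; have := gE i i_in; have := lab_app_le g i.
move: (lab_app g i) => j j_le jE; clearbody d d'.
have j_in : 0 < j <= n.
  by clear - i0 b_def d_n q_def q_in jE j_le i_in b_le ia ib ibn; cases_lia.
have := rE j j_in; move: (lab_app r j) => k kE.
clear - q_def q_in c_def kE i0 b_def d_n jE j_in i_in b_le ia ib ibn.
have [i_ab|i_out] := boolP (a < i < b); [left | right].
  have j_i : j = i by clear kE c_def; cases_lia.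
  by clear jE d_n b_def; cases_lia.
have {}jE : j + i + d = 2 * q + n \/ j + i + d = 2 * q \/ j + i + d + n = 2 * q.
  by clear kE c_def; cases_lia.
split; first by clear jE c_def kE; lia.
by clear i_out ia ib ibn i0; cases_lia.
Qed.

(** * Parity-preserving maps *)

(** Deleting the ends and the cut point makes the map known at every label. Both [s] and [s + n]
    name the cut point, but only one of them is a label. *)
Lemma flip s a b : s <= 1 -> s <= a < b -> b <= s + n -> odd a = odd b ->
  exists2 g, g \in S & forall i, 0 < i <= n ->
    (i = a \/ i = b \/ i = s \/ i = s + n) /\ lab_app g i = 0 \/
    i <> a /\ i <> b /\ i <> s /\ i <> s + n /\
      (a < i < b /\ lab_app g i + i = a + b \/ (i < a \/ b < i) /\ lab_app g i = i).
Proof.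
move=> s_le1 s_a b_le ab_odd; have [|||g gS gE] := flip_core a b; [lia|lia|lia|].
pose D i := i \notin [:: a; b; s; s + n].
exists (mk_ptrans n D id * g)%g => [|i i_in]; first exact/sgenM/gS/sgen_pid.
have DE : D i <-> i <> a /\ i <> b /\ i <> s /\ i <> s + n.
  rewrite /D !inE !negb_or; split=> [/and4P[/eqP ? /eqP ? /eqP ? /eqP ?] //|].
  by case=> ? [? [? ?]]; apply/and4P; split; apply/eqP.
rewrite lab_appM pidE //; case: ifP => [/DE[ia [ib [is1 is2]]]|nDi].
  right; do 4!split=> //; clear DE ab_odd n_even.
  by apply: gE => //; [clear - b_le is1 i_in s_le1; lia | clear - s_a is2 s_le1; lia].
left; split; last by rewrite lab_app_out; auto.
by clear DE; move: nDi; rewrite /D !inE; clear; lia.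
Qed.

(* The circle is cut at an undefined point, of label [n] if [s = 0] and [1] if
   [s = 1], so that adjacency no longer wraps around; [a] fixes the points up to [k]. *)
Definition linear s k (a : ptrans n) := forall i, lab_app a i <> 0 ->
  [/\ s < i < s + n, s < lab_app a i < s + n, odd (lab_app a i) = odd i,
      i <= k -> lab_app a i = i
    & lab_app a i.+1 <> 0 ->
      lab_app a i.+1 = (lab_app a i).+1 \/ lab_app a i = (lab_app a i.+1).+1].

Definition linear_pair s k a b := [/\ mutual_inverse a b, linear s k a & linear s k b].

Lemma linear_pair_sym s k a b : linear_pair s k a b -> linear_pair s k b a.
Proof. by case=> ab la lb; split=> //; apply: mutual_inverse_sym. Qed.

(** Since [x] and [y] are holes of the image of [a], the reversal between them loses no image point
    and keeps successors together; [k <= x] protects the fixed initial segment. Applying the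
    reversal twice gives back [a] and [b], so membership can be pulled back. *)
Lemma linear_pair_flip s k a b x y : s <= 1 -> linear_pair s k a b ->
    s <= x -> k <= x < y -> y <= s + n -> odd x = odd y ->
    lab_app b x = 0 -> lab_app b y = 0 ->
  exists g : ptrans n,
    [/\ linear_pair s k (a * g)%g (g * b)%g,
        forall i, i <> x -> i <> y -> s < i < s + n ->
          x < i < y /\ lab_app g i + i = x + y \/ (i < x \/ y < i) /\ lab_app g i = i,
        lab_app g x = 0, lab_app g y = 0
      & (a * g)%g \in S /\ (g * b)%g \in S -> a \in S /\ b \in S].
Proof.
move=> s_le1 [[aK bK] la lb] s_x k_x y_le xy_odd bx by0.
have [||||g gS gE] := flip s x y; [lia|lia|lia|lia|].
have g0 i : ~~ (s < i < s + n) -> lab_app g i = 0.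
  move=> i_out; have [i_in|out] := boolP (0 < i <= n); last by rewrite lab_app_out; lia.
  have : i = s \/ i = s + n by lia.
  by move=> i_s; have giE := gE i i_in; clear - i_s giE; cases_lia.
have gx : lab_app g x = 0.
  have [x_in|out] := boolP (0 < x <= n); last by rewrite lab_app_out; lia.
  by have gxE := gE x x_in; clear - gxE; cases_lia.
have gy : lab_app g y = 0.
  have [y_in|out] := boolP (0 < y <= n); last by rewrite lab_app_out; lia.
  by have gyE := gE y y_in; clear - gyE; cases_lia.
have {}gE i : i <> x -> i <> y -> s < i < s + n ->
    x < i < y /\ lab_app g i + i = x + y \/ (i < x \/ y < i) /\ lab_app g i = i.
  move=> ix iy i_in; have i_in' : 0 < i <= n by lia.
  by have giE := gE i i_in'; clear - ix iy i_in giE; cases_lia.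
have gN0 i : lab_app g i <> 0 -> [/\ i <> x, i <> y & s < i < s + n].
  by move=> gi; split=> [ix|iy|]; [rewrite ix in gi|rewrite iy in gi|apply: contraT => /g0].
have gK i : lab_app g i <> 0 -> lab_app g (lab_app g i) = i.
  case/gN0=> ix iy i_in; have := gE i ix iy i_in; move: (lab_app g i) => j jE.
  have [jx jy j_in] : [/\ j <> x, j <> y & s < j < s + n].
    by clear - jE ix iy i_in s_x y_le; split; cases_lia.
  by have := gE j jx jy j_in; clear - s_x y_le ix iy i_in jE; move: (lab_app g j) => u uE; cases_lia.
have g_in i : lab_app g i <> 0 -> s < lab_app g i < s + n.
  case/gN0=> ix iy i_in; have := gE i ix iy i_in; clear - s_x y_le i_in => giE; cases_lia.
have g_odd i : lab_app g i <> 0 -> odd (lab_app g i) = odd i.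
  case/gN0=> ix iy i_in; have := gE i ix iy i_in; clear - xy_odd => giE; cases_lia.
have g_k i : lab_app g i <> 0 -> i <= k -> lab_app g i = i.
  case/gN0=> ix iy i_in; have := gE i ix iy i_in; clear - k_x => giE i_k; cases_lia.
have aN0 i : lab_app a i <> 0 ->
    [/\ lab_app a i <> x, lab_app a i <> y & s < lab_app a i < s + n].
  move=> ai; have [i_in ai_in _ _ _] := la i ai.
  by split=> // eq_ai; have := aK i ai; rewrite eq_ai; lia.
exists g; split=> //; last first.
  case=> agS gbS; have gaK : a = (a * g * g)%g.
    apply: lab_app_inj => i; rewrite !lab_appM.
    have [->|/eqP ai] := eqVneq (lab_app a i) 0; first by rewrite !lab_app_out; auto.
    have [nx ny a_in] := aN0 i ai; rewrite gK //.
    by have := gE _ nx ny a_in; lia.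
  have gbK : b = (g * (g * b))%g.
    apply: lab_app_inj => i; rewrite !lab_appM.
    have [bi|/eqP bi] := eqVneq (lab_app b i) 0.
      have [gi|/eqP gi] := eqVneq (lab_app g i) 0; last by rewrite gK ?bi.
      by rewrite gi bi !lab_app_out; auto.
    have [i_in _ _ _ _] := lb i bi.
    have ix : i <> x by move=> ix; rewrite ix in bi.
    have iy : i <> y by move=> iy; rewrite iy in bi.
    by rewrite gK //; have := gE i ix iy i_in; lia.
  by split; [rewrite gaK | rewrite gbK]; apply: sgenM.
split; first exact: mutual_inverseM.
  move=> i; rewrite !lab_appM => gai.
  have ai : lab_app a i <> 0 by move=> ai; rewrite ai lab_app_out in gai; auto.
  have [i_in ai_in ai_odd ai_k ai_adj] := la i ai.
  split=> //; [exact: g_in | by rewrite g_odd | |].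
    by move=> i_k; have a_i := ai_k i_k; rewrite a_i in gai *; apply: g_k.
  move=> gai1; have ai1 : lab_app a i.+1 <> 0.
    by move=> ai1; rewrite ai1 lab_app_out in gai1; auto.
  have [nx ny _] := aN0 i ai; have := gE _ nx ny ai_in.
  have [nx1 ny1 ai1_in] := aN0 i.+1 ai1; have := gE _ nx1 ny1 ai1_in.
  have := ai_adj ai1; clear - nx ny nx1 ny1 => *; cases_lia.
move=> i; rewrite !lab_appM => bgi.
have gi : lab_app g i <> 0 by move=> gi; rewrite gi lab_app_out in bgi; auto.
have [ix iy i_in] := gN0 i gi; have := gE i ix iy i_in => giE.
have [gi_in bgi_in bgi_odd bgi_k bgi_adj] := lb _ bgi.
split=> //; first by rewrite bgi_odd g_odd.
  by move=> i_k; have g_i := g_k i gi i_k; rewrite g_i in bgi_k *; apply: bgi_k.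
move=> bgi1.
have gi1 : lab_app g i.+1 <> 0 by move=> gi1; rewrite gi1 lab_app_out in bgi1; auto.
have [ix1 iy1 i1_in] := gN0 i.+1 gi1; have := gE i.+1 ix1 iy1 i1_in => gi1E.
have [_ _ _ _ bgi1_adj] := lb _ bgi1.
have [e1|e1] : lab_app g i.+1 = (lab_app g i).+1 \/ lab_app g i = (lab_app g i.+1).+1.
- by clear - ix iy ix1 iy1 giE gi1E; cases_lia.
- by rewrite e1 in bgi1 *; apply: bgi_adj.
by rewrite e1 in bgi *; case: (bgi1_adj bgi); auto.
Qed.

Lemma linear_pair_succ s k a b : linear_pair s k a b ->
    (lab_app a k.+1 <> 0 -> lab_app a k.+1 = k.+1) ->
    (lab_app b k.+1 <> 0 -> lab_app b k.+1 = k.+1) ->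
  linear_pair s k.+1 a b.
Proof.
case=> ab la lb ak bk; split=> // i i_neq0.
  have [? ? ? i_k ?] := la i i_neq0; split=> //.
  by rewrite leq_eqVlt => /orP[/eqP ik|]; [rewrite ik in i_neq0 *; apply: ak | apply: i_k].
have [? ? ? i_k ?] := lb i i_neq0; split=> //.
by rewrite leq_eqVlt => /orP[/eqP ik|]; [rewrite ik in i_neq0 *; apply: bk | apply: i_k].
Qed.

Lemma linear_pair_last s k a b : s <= 1 -> s + n <= k.+1 -> linear_pair s k a b ->
  a \in S /\ b \in S.
Proof.
by move=> s_le1 k_big [_ la lb]; split; apply: sgen_partial_identity => i i_neq0;
   [have [? _ _ -> //] := la i i_neq0 | have [? _ _ -> //] := lb i i_neq0]; lia.
Qed.

Section Step.

Context (s k : nat) (s_le1 : s <= 1) (s_k : s <= k).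
Context (IH : forall a b, linear_pair s k.+1 a b -> a \in S /\ b \in S).

(** The holes [k] and [y.+1] have the same parity because [y] has that of [k.+1], and the reversal
    between them sends [y] to [k.+1]. *)
Lemma linear_step_flip a b y : linear_pair s k a b -> lab_app b k = 0 ->
    lab_app a k.+1 = y -> y <> 0 -> k < y -> lab_app b y.+1 = 0 ->
  a \in S /\ b \in S.
Proof.
move=> abL bk ay y_neq0 k_y by1; have [[aK bK] la lb] := abL.
have [k_in y_in y_odd _ _] : [/\ s < k.+1 < s + n, s < y < s + n, odd y = odd k.+1, True & True].
  by have [] := la k.+1; rewrite ay.
have [||||||g [abgL gE gk gy agS]] := linear_pair_flip s k a b k y.+1 s_le1 abL; try by [] || lia.
apply: agS; apply: IH; have [[agK bgK] _ _] := abgL.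
have ag : lab_app (a * g)%g k.+1 = k.+1.
  rewrite lab_appM ay; have [yk y1] : y <> k /\ y <> y.+1 by clear - k_y; lia.
  by have := gE y yk y1 y_in; clear - k_y; lia.
apply: linear_pair_succ => // bg; rewrite -{1}ag agK //; lia.
Qed.

(** If a hole follows [y], one reversal is enough. Otherwise [y] is the left end of a path of the
    image; reversing the arc from [u] to [v] around it makes it a right end, followed by a hole, and
    a second reversal finishes. *)
Lemma linear_step_flip2 a b y : linear_pair s k a b ->
    lab_app a k = 0 -> lab_app b k = 0 ->
    lab_app a k.+1 = y -> y <> 0 -> k.+1 < y ->
    (exists u v, [/\ k <= u < y, y < v <= s + n, odd u = odd v, lab_app b u = 0 & lab_app b v = 0]) ->
  a \in S /\ b \in S.
Proof.
move=> abL ak bk ay y_neq0 k_y [u [v [k_u y_v uv_odd bu bv]]]; have [[aK bK] la lb] := abL.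
have by0 : lab_app b y = k.+1 by rewrite -ay aK ?ay.
have y_in : s < y < s + n by have [] := la k.+1; rewrite ay.
have [by1|/eqP by1] := eqVneq (lab_app b y.+1) 0.
  by apply: (linear_step_flip a b y) => //; lia.
(* Were [y.-1] and [y.+1] both in the image, their preimages would be neighbours of [k.+1]; as [k]
   is not in the domain, both would be [k.+2]. *)
have by2 : lab_app b y.-1 = 0.
  have def_y : y.-1.+1 = y by lia.
  apply/eqP/negPn/negP=> /eqP by2.
  have bk_neq i : lab_app b i <> 0 -> lab_app b i <> k.
    by move=> bi eq_bi; have := bK i bi; rewrite eq_bi ak => i0; rewrite -i0 lab_app_out in bi; auto.
  have [_ _ _ _ /(_ by1) adj1] := lb y ltac:(by rewrite by0).
  have [_ _ _ _] := lb _ by2; rewrite def_y by0 => /(_ ltac:(by [])) adj2.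
  have b_eq : lab_app b y.+1 = lab_app b y.-1.
    by have := bk_neq _ by1; have := bk_neq _ by2; lia.
  by have := bK _ by1; rewrite b_eq bK //; lia.
have [||||||g [abgL gE gu gv agS]] := linear_pair_flip s k a b u v s_le1 abL; try by [] || lia.
have gy : lab_app g y + y = u + v.
  have [yu yv] : y <> u /\ y <> v by clear - k_u y_v; lia.
  by have := gE y yu yv y_in; clear - k_u y_v; lia.
apply: agS; have [[agK bgK] _ lbg] := abgL.
apply: (linear_step_flip _ _ (lab_app g y)) => //; try by lia.
- apply/eqP/negPn/negP=> /eqP bgk; have [_ _ _ /(_ (leqnn k)) bg_k _] := lbg k bgk.
  by have := bgK k bgk; rewrite bg_k lab_appM ak lab_app_out; lia.
- by rewrite lab_appM ay.
(* The hole after the new position of [y] is [v] itself if [u = y.-1], and the reflected hole [y.-1]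
   otherwise. *)
rewrite lab_appM; have [u_y|u_y] := eqVneq u y.-1.
  have gy1 : (lab_app g y).+1 = v by lia.
  by rewrite gy1 gv lab_app_out; auto.
suff -> : lab_app g (lab_app g y).+1 = y.-1 by [].
have [gyu gyv gy_in gy_uv] : [/\ (lab_app g y).+1 <> u, (lab_app g y).+1 <> v,
    s < (lab_app g y).+1 < s + n & u < (lab_app g y).+1 < v].
  by clear - gy u_y k_u y_v s_k; split; lia.
by have := gE _ gyu gyv gy_in; clear - gy gy_uv; lia.
Qed.

(* If no single pair of holes of the image suits [linear_step_flip2], the path
   leaving [k] has an even number of points, and its end [u] in the domain together
   with the base hole suits [linear_step_flip2] for the inverse map. *)
Lemma linear_step_far a b y : linear_pair s k a b ->
    lab_app a k = 0 -> lab_app b k = 0 ->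
    lab_app a k.+1 = y -> y <> 0 -> k.+1 < y ->
  a \in S /\ b \in S.
Proof.
move=> abL ak bk ay y_neq0 k_y; have [[aK bK] la lb] := abL.
have by0 : lab_app b y = k.+1 by rewrite -ay aK ?ay.
have [k_in y_in y_odd] : [/\ s < k.+1 < s + n, s < y < s + n & odd y = odd k.+1].
  by have [] := la k.+1; rewrite ay.
have [by1|/eqP by1] := eqVneq (lab_app b y.+1) 0.
  by apply: (linear_step_flip a b y) => //; lia.
have b_out i : s + n <= i -> lab_app b i = 0.
  by move=> i_big; apply/eqP/negPn/negP=> /eqP/lb[]; lia.
have a_out i : s + n <= i -> lab_app a i = 0.
  by move=> i_big; apply/eqP/negPn/negP=> /eqP/la[]; lia.
(* [v] is the first hole of the image after [y]; it exists because the cut point [s + n] is a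
   hole. *)
have [v] : exists2 v, y < v <= s + n /\ lab_app b v = 0 &
    forall i, y <= i < v -> lab_app b i <> 0.
  have ex_v : exists v, (y < v) && (lab_app b v == 0).
    by exists (s + n); rewrite b_out ?eqxx //; lia.
  case: (ex_minnP ex_v) => v /andP[y_v /eqP bv] v_min; exists v.
    by split=> //; rewrite y_v v_min // b_out ?eqxx //; lia.
  move=> i i_in bi; have := v_min i; rewrite bi eqxx andbT => /(_ _).
  by have [i_y|] := eqVneq i y; [rewrite i_y by0 in bi | lia].
move=> [y_v bv] v_min.
have [kv_odd|kv_odd] := boolP (odd k == odd v).
  apply: (linear_step_flip2 a b y) => //; exists k, v.
  by split=> //; [lia | exact/eqP].
have v_y : y.+1 < v by lia.
have bk_neq i : lab_app b i <> 0 -> lab_app b i <> k.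
  by move=> bi eq_bi; have := bK i bi; rewrite eq_bi ak => i0; rewrite -i0 lab_app_out in bi; auto.
(* The image path from [y] to [v.-1] comes from consecutive points starting at [k.+1]: injectivity
   forbids turning back, and [k] is not in the domain. *)
have b_path t : y + t < v -> lab_app b (y + t) = k.+1 + t.
  elim/ltn_ind: t => -[|t] IHt t_v; first by rewrite !addn0.
  have bt : lab_app b (y + t) = k.+1 + t by apply: IHt; lia.
  have bt1 : lab_app b (y + t).+1 <> 0 by apply: v_min; lia.
  have [_ _ _ _ /(_ bt1)] := lb (y + t) ltac:(by rewrite bt).
  rewrite bt !addnS => -[//|eq_bt]; case: t IHt t_v bt bt1 eq_bt => [|t] IHt t_v bt bt1 eq_bt.
    by case: (bk_neq _ bt1); lia.
  have bt2 : lab_app b (y + t) = k.+1 + t by apply: IHt; lia.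
  have := bK _ bt1; rewrite (_ : lab_app b _ = lab_app b (y + t)); last by lia.
  by rewrite bK; lia.
have a_path t : y + t < v -> lab_app a (k.+1 + t) = y + t.
  by move=> t_v; rewrite -b_path // bK // b_path.
pose u := k.+1 + (v - y).
have au : lab_app a u = 0.
  apply/eqP/negPn/negP=> /eqP au.
  have a1 := a_path (v - y).-1 ltac:(clear - v_y; lia).
  have a2 := a_path (v - y).-2 ltac:(clear - v_y; lia).
  have def_u : u = (k.+1 + (v - y).-1).+1 by rewrite /u; clear - v_y; lia.
  have [_ _ _ _] := la (k.+1 + (v - y).-1) ltac:(by rewrite a1; clear - y_neq0; lia).
  rewrite -def_u => /(_ au) [eq_au|eq_au].
    have v_au : lab_app a u = v by rewrite eq_au a1; clear - v_y; lia.
    by have := aK u au; rewrite v_au bv /u; clear; lia.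
  have eq_a : lab_app a u = lab_app a (k.+1 + (v - y).-2).
    by rewrite a2; move: eq_au; rewrite a1; clear - v_y; lia.
  by have := aK u au; rewrite eq_a aK ?a2 /u; clear - v_y y_neq0; lia.
have u_odd : odd u = ~~ odd k.
  by rewrite /u oddD oddB ?(ltnW (ltnW v_y)) // y_odd /=; case: (odd k) (odd v) kv_odd => -[].
have [ks_odd|ks_odd] := boolP (odd k == odd (s + n)).
  apply: (linear_step_flip2 a b y) => //; exists k, (s + n).
  split=> //; [by rewrite leqnn ltnW | by case/andP: y_in => _ -> /= | exact/eqP | exact: b_out].
have k_u : k <= u by rewrite /u addSnnS leq_addr.
(* Now [v] and [s + n] both have the parity of [k.+1]. If [k.+1] is a hole of the image, it pairs
   with [v]. *)
have [bk1|/eqP bk1] := eqVneq (lab_app b k.+1) 0.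
  apply: (linear_step_flip2 a b y) => //; exists k.+1, v.
  split=> //; first by rewrite leqnSn.
  by rewrite /=; case: (odd k) (odd v) kv_odd => -[].
have [x_in k1_in x_odd x_k _] := lb _ bk1.
have x_neq : lab_app b k.+1 <> k.+1.
  by move=> x_eq; have := bK _ bk1; rewrite x_eq ay => y_eq; rewrite y_eq ltnn in k_y.
have x_gt : k.+1 < lab_app b k.+1.
  rewrite ltn_neqAle eq_sym; apply/andP; split; first exact/eqP.
  rewrite ltnNge; apply/negP=> x_le.
  have [_ _ _ /(_ x_le)] := la (lab_app b k.+1) ltac:(by rewrite bK).
  by rewrite bK // => k1_eq _; rewrite -k1_eq ltnn in x_le.
(* Otherwise the roles of [a] and [b] are exchanged: the preimage of [k.+1] lies beyond [u], since
   the path before [u] is mapped to labels from [y] on. *)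
suff [] : b \in S /\ a \in S by [].
apply: (linear_step_flip2 b a (lab_app b k.+1)) => //.
exists u, (s + n); split=> //; last exact: a_out.
- rewrite k_u /= ltnNge; apply/negP=> x_le; have [x_u|x_u] := eqVneq (lab_app b k.+1) u.
    by have := bK _ bk1; rewrite x_u au.
  have x_t := a_path (lab_app b k.+1 - k.+1).
  rewrite subnKC ?bK // in x_t; last exact: ltnW.
  have : y + (lab_app b k.+1 - k.+1) < v.
    by rewrite /u in x_le x_u; clear - x_gt x_le x_u v_y; lia.
  by move/x_t; clear - k_y; lia.
- by rewrite leqnn andbT; case/andP: k1_in.
by rewrite u_odd; case: (odd k) (odd (s + n)) ks_odd => -[].
Qed.

(** If neither map moves [k.+1], the fixed segment grows at once. Otherwise, up to exchanging the
    maps, [a] moves [k.+1] further right; then [k] is a hole on both sides, because a value at [k]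
    would be [k] and would keep the image of [k.+1] next to it. *)
Lemma linear_step a b : linear_pair s k a b -> a \in S /\ b \in S.
Proof.
move=> abL; have [[aK bK] la lb] := abL.
wlog ak1 : a b abL aK bK la lb / lab_app a k.+1 <> 0 /\ lab_app a k.+1 <> k.+1.
  move=> wlog_ab; have baL := linear_pair_sym _ _ _ _ abL.
  have [a_ok|a_ok] := boolP (lab_app a k.+1 \in [:: 0; k.+1]); last first.
    by apply: wlog_ab => //; rewrite !inE in a_ok; lia.
  have [b_ok|b_ok] := boolP (lab_app b k.+1 \in [:: 0; k.+1]); last first.
    suff [] : b \in S /\ a \in S by [].
    by apply: wlog_ab => //; rewrite !inE in b_ok; lia.
  apply: IH; apply: linear_pair_succ => //; rewrite !inE in a_ok b_ok; lia.
case: ak1 => ak1_neq0 ak1_neq; set y := lab_app a k.+1 in ak1_neq0 ak1_neq.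
have by0 : lab_app b y = k.+1 by rewrite aK.
have y_gt : k.+1 < y.
  rewrite ltnNge; apply/negP=> y_le; have {}y_le : y <= k by lia.
  by have [_ _ _ /(_ y_le)] := lb y ltac:(by rewrite by0); lia.
have ak : lab_app a k = 0.
  apply/eqP/negPn/negP=> /eqP ak; have [_ _ _ /(_ (leqnn k)) a_k /(_ ak1_neq0)] := la k ak.
  by rewrite a_k; lia.
have bk : lab_app b k = 0.
  apply/eqP/negPn/negP=> /eqP bk; have [_ _ _ /(_ (leqnn k)) b_k _] := lb k bk.
  by have := bK k bk; rewrite b_k ak => k0; rewrite -k0 lab_app_out in bk; auto.
exact: (linear_step_far a b y).
Qed.

End Step.

Lemma linear_pair_sgen s k a b : s <= 1 -> s <= k -> linear_pair s k a b ->
  a \in S /\ b \in S.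
Proof.
move=> s_le1; have [m] := ubnP (s + n - k); elim: m k a b => // m IHm k a b k_m s_k abL.
have [k_big|k_small] := leqP (s + n) k.
  by apply: (linear_pair_last s k) => //; lia.
by apply: (linear_step s k) => // a' b'; apply: IHm; lia.
Qed.

(** * From the circle to the cut line *)

Definition inverse_pair (a b : ptrans n) := [/\ mutual_inverse a b, in_crown a & in_crown b].

Lemma inverse_pair_sym a b : inverse_pair a b -> inverse_pair b a.
Proof. by case=> ab ca cb; split=> //; apply: mutual_inverse_sym. Qed.

(** These serve as changes of coordinates: multiplying by them on either side does not affect
    membership in [S]. *)
Definition symmetry_pair (g h : ptrans n) :=
  [/\ g \in S, h \in S, mutual_inverse g h,
      forall i, 0 < i <= n -> lab_app g i <> 0 /\ odd (lab_app g i) = odd i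
    & forall i, 0 < i <= n -> lab_app h i <> 0 /\ odd (lab_app h i) = odd i].

Lemma symmetry_pair_sym g h : symmetry_pair g h -> symmetry_pair h g.
Proof. by case=> gS hS gh g_ok h_ok; split=> //; apply: mutual_inverse_sym. Qed.

Lemma symmetry_pairK g h : symmetry_pair g h -> (g * h)%g = 1%g.
Proof.
case=> _ _ [gK _] g_ok _; apply: lab_app_inj => i; rewrite lab_appM.
have [i_in|i_out] := boolP (0 < i <= n); last by rewrite !lab_app_out; lia.
have [gi _] := g_ok i i_in; rewrite gK //.
by have [x <-] := label_onto i i_in; rewrite lab_appE /papp ffunE.
Qed.

Lemma rotation_pair x y : 0 < x <= n -> 0 < y <= n -> odd x = odd y ->
  exists g h, symmetry_pair g h /\ lab_app g x = y.
Proof.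
move=> x_in y_in xy_odd.
have [d [d' [d_even d'_even d_n d_def]]] : exists d d',
    [/\ ~~ odd d, ~~ odd d', d + d' = n & y = x + d \/ y + n = x + d].
  have [le_xy|lt_yx] := leqP x y.
    by exists (y - x), (n - (y - x)); split; lia.
  by exists (y + n - x), (x - y); split; lia.
have [||g gS gE] := rotation d; [lia|lia|].
have [||h hS hE] := rotation d'; [lia|lia|].
exists g, h; split; last by have := gE x x_in; lia.
split=> //; last 2 first.
- by move=> i i_in; have := gE i i_in; clear xy_odd; lia.
- by move=> i i_in; have := hE i i_in; clear xy_odd; lia.
split=> i /lab_app_range[i_in].
  have := gE i i_in; move: (lab_app g i) => j jE j_in; have := hE j j_in.
  by clear - jE j_in i_in d_n; lia.
have := hE i i_in; move: (lab_app h i) => j jE j_in; have := gE j j_in.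
by clear - jE j_in i_in d_n; lia.
Qed.

Lemma reflection_pair c : ~~ odd c -> 2 <= c <= n ->
  exists r, symmetry_pair r r /\ forall i, 0 < i <= n ->
    0 < lab_app r i <= n /\ (lab_app r i + i = c \/ lab_app r i + i = c + n).
Proof.
move=> c_even c_in; have [||r rS rE] := reflection c; [lia|lia|].
exists r; split=> //.
have r_ok i : 0 < i <= n -> lab_app r i <> 0 /\ odd (lab_app r i) = odd i.
  by move=> i_in; have := rE i i_in; lia.
have rK i : lab_app r i <> 0 -> lab_app r (lab_app r i) = i.
  case/lab_app_range=> i_in r_in; have := rE i i_in; have := rE _ r_in.
  by move: (lab_app r i) (lab_app r _); clear - i_in; lia.
by split.
Qed.

Lemma sgen_symmetryr a g h : symmetry_pair g h -> (a * g)%g \in S -> a \in S.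
Proof.
move=> gh agS; have [_ hS _ _ _] := gh.
by rewrite -(mulg1 a) -(symmetry_pairK g h gh) mulgA; apply: sgenM.
Qed.

Lemma sgen_symmetryl a g h : symmetry_pair g h -> (h * a)%g \in S -> a \in S.
Proof.
move=> gh haS; have [gS _ _ _ _] := gh.
by rewrite -(mul1g a) -(symmetry_pairK g h gh) -mulgA; apply: sgenM.
Qed.

Definition parity_preserving (a : ptrans n) :=
  forall i, lab_app a i <> 0 -> odd (lab_app a i) = odd i.

(** Adjacency on the circle differs from succession only for the pair 1, [n], and the common hole
    [c] is one of these two. At level [s] the fixing condition is vacuous. *)
Lemma linear_pair_cut s c a b : s = 0 /\ c = n \/ s = 1 /\ c = 1 ->
    inverse_pair a b -> parity_preserving a -> parity_preserving b ->
    lab_app a c = 0 -> lab_app b c = 0 ->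
  linear_pair s s a b.
Proof.
move=> s_c ab a_odd b_odd.
wlog suff lin : a b ab a_odd b_odd / lab_app a c = 0 -> lab_app b c = 0 -> linear s s a.
  move=> ac bc; split; [by case: ab | exact: (lin a b) | apply: (lin b a) => //].
  exact: inverse_pair_sym.
move=> ac bc i ai; case: ab => [[aK _] [a_inj a_cr] _].
have [i_in ai_in] := lab_app_range a i ai.
have i_c : i <> c by move=> i_c; rewrite i_c in ai.
have ai_c : lab_app a i <> c by move=> ai_c; have := aK i ai; rewrite ai_c bc; lia.
have s_i : s < i < s + n by clear - s_c i_in i_c; cases_lia.
have s_ai : s < lab_app a i < s + n by clear - s_c ai_in ai_c; cases_lia.
split=> //; [exact: a_odd | by clear - s_i; lia | move=> ai1].
have [i1_in ai1_in] := lab_app_range a i.+1 ai1.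
have ai1_c : lab_app a i.+1 <> c by move=> ai1_c; have := aK _ ai1; rewrite ai1_c bc; lia.
have adj : adjacent (lab_app a i) (lab_app a i.+1) \/ adjacent (lab_app a i.+1) (lab_app a i).
  have [i_odd|i_even] := boolP (odd i).
    left; have := a_cr i i.+1 ai ai1; rewrite {1}/crown_lab i_odd eqxx.
    by move/esym/crown_labP=> [].
  right; have := a_cr i.+1 i ai1 ai; rewrite {1}/crown_lab /= i_even eqxx orbT.
  by move/esym/crown_labP=> [].
rewrite /adjacent in adj; clear - s_c s_i s_ai ai1_in ai1_c adj; cases_lia.
Qed.

Definition parity_class (p : nat) := [seq i <- iota 1 n | odd i == odd p].

Lemma mem_parity_class p i : (i \in parity_class p) = (odd i == odd p) && (0 < i <= n).
Proof. by rewrite mem_filter mem_iota add1n ltnS. Qed.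

(** If [a] were defined on the whole class of [p], it would permute this finite class and [p] would
    be an image. *)
Lemma parity_hole a b p : mutual_inverse a b -> parity_preserving a ->
    0 < p <= n -> lab_app b p = 0 ->
  exists q, [/\ 0 < q <= n, odd q = odd p & lab_app a q = 0].
Proof.
move=> [aK _] a_odd p_in bp.
have [/hasP[q]|/hasPn a_full] := boolP (has (fun q => lab_app a q == 0) (parity_class p)).
  by rewrite mem_parity_class => /andP[/eqP pq q_in] /eqP aq; exists q.
have {}a_full i : i \in parity_class p -> lab_app a i <> 0 by move/a_full/eqP.
have a_uniq : uniq (map (lab_app a) (parity_class p)).
  rewrite map_inj_in_uniq ?filter_uniq ?iota_uniq // => i j /a_full ai /a_full aj eq_a.
  by rewrite -(aK i ai) eq_a aK.
have a_sub : {subset map (lab_app a) (parity_class p) <= parity_class p}.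
  move=> _ /mapP[i i_p ->]; have ai := a_full i i_p.
  move: i_p; rewrite !mem_parity_class a_odd // => /andP[-> _].
  by have [_ ->] := lab_app_range a i ai.
have [_ eq_p] := uniq_min_size a_uniq a_sub (eq_leq (esym (size_map _ _))).
have : p \in map (lab_app a) (parity_class p) by rewrite eq_p mem_parity_class eqxx.
case/mapP=> i /a_full ai def_p.
by have i0 := aK i ai; rewrite -def_p bp in i0; rewrite -i0 lab_app_out in ai; auto.
Qed.

Lemma inverse_pairM a b c d : inverse_pair a b -> inverse_pair c d ->
  inverse_pair (a * c)%g (d * b)%g.
Proof.
by case=> ab ca cb [cd cc cd']; split; [apply: mutual_inverseM | apply: in_crownM ..].
Qed.

Lemma symmetry_inverse_pair g h : symmetry_pair g h -> inverse_pair g h.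
Proof. by case=> gS hS gh _ _; split=> //; apply: sgen_in_crown. Qed.

Lemma sgen_hole a b p q : inverse_pair a b -> parity_preserving a -> parity_preserving b ->
    0 < p <= n -> 0 < q <= n -> odd p = odd q -> lab_app a p = 0 -> lab_app b q = 0 ->
  a \in S /\ b \in S.
Proof.
move=> ab a_odd b_odd p_in q_in pq_odd ap bq.
have [s [c [s_c c_in c_odd]]] : exists s c,
    [/\ s = 0 /\ c = n \/ s = 1 /\ c = 1, 0 < c <= n & odd c = odd p].
  have [p_odd|p_even] := boolP (odd p); first by exists 1, 1; split; auto; lia.
  by exists 0, n; split; auto; lia.
(* [g] carries [c] to the hole of the domain and [h] carries [c] to the hole of the image, so
   [g * a * h'] and its inverse are both undefined at [c]. *)
have [g [g' [gg' gc]]] := rotation_pair c p c_in p_in c_odd.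
have [h [h' [hh' hc]]] := rotation_pair c q c_in q_in (etrans c_odd pq_odd).
have pp_sym u v : symmetry_pair u v -> parity_preserving u.
  by case=> _ _ _ u_ok _ i /lab_app_range[/u_ok[]].
have pp_mul u v : parity_preserving u -> parity_preserving v -> parity_preserving (u * v)%g.
  move=> u_pp v_pp i; rewrite lab_appM => uvi; rewrite v_pp // u_pp // => ui.
  by rewrite ui lab_app_out in uvi; auto.
have g'g := symmetry_pair_sym _ _ gg'; have h'h := symmetry_pair_sym _ _ hh'.
have [|||||] := linear_pair_cut s c (g * a * h')%g (h * (b * g'))%g s_c.
- apply: inverse_pairM; last exact: symmetry_inverse_pair.
  by apply: inverse_pairM; first exact: symmetry_inverse_pair.
- apply: (pp_mul) (pp_sym _ _ h'h); exact: pp_mul (pp_sym _ _ gg') a_odd.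
- apply: (pp_mul) (pp_sym _ _ hh') _; exact: pp_mul b_odd (pp_sym _ _ g'g).
- by rewrite !lab_appM gc ap lab_app_out; auto.
- by rewrite !lab_appM hc bq lab_app_out; auto.
move=> mi la lb; have [||gahS hbgS] := linear_pair_sgen s s _ _ _ _ (And3 mi la lb).
- by lia.
- by [].
split; first by apply: (sgen_symmetryl _ _ _ g'g); apply: (sgen_symmetryr _ _ _ h'h).
apply: (sgen_symmetryr _ _ _ g'g); exact: (sgen_symmetryl _ _ _ h'h).
Qed.

(** After a rotation and perhaps a reflection 1 and 2 are fixed. Then everything is fixed,
    inductively: the image of [k.+2] is the neighbour of [k.+1] other than [k]. *)
Lemma sgen_full a : in_crown a -> (forall i, 0 < i <= n -> lab_app a i <> 0) -> a \in S.
Proof.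
have fix12 c : in_crown c -> (forall i, 0 < i <= n -> lab_app c i <> 0) ->
    lab_app c 1 = 1 -> lab_app c 2 = 2 -> c \in S.
  case=> c_inj c_cr c_full c1 c2; apply: sgen_partial_identity => i ci.
  suff cP k : 0 < k < n -> lab_app c k = k /\ lab_app c k.+1 = k.+1.
    have [i_in _] := lab_app_range c i ci.
    have [i1|i1] := eqVneq i 1; first by rewrite i1.
    by have [|_] := cP i.-1; [lia | rewrite prednK //; lia].
  elim: k => // k IHk k_in; have [k0|k_gt0] := posnP k; first by rewrite k0.
  have [ck ck1] : lab_app c k = k /\ lab_app c k.+1 = k.+1 by apply: IHk; lia.
  split=> //; have ck1_neq0 : lab_app c k.+1 <> 0 by rewrite ck1.
  have ck2_neq0 : lab_app c k.+2 <> 0 by apply: c_full; lia.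
  have := c_cr _ _ ck1_neq0 ck2_neq0; have := c_cr _ _ ck2_neq0 ck1_neq0.
  have : lab_app c k.+2 <> k.
    by move=> eq_k; have := c_inj k k.+2; rewrite eq_k ck; lia.
  have [_] := lab_app_range c _ ck2_neq0.
  by rewrite ck1 /crown_lab; clear - k_in k_gt0; lia.
move=> ca a_full; have [a_inj a_cr] := ca.
have symM c g h : symmetry_pair g h -> in_crown c ->
    (forall i, 0 < i <= n -> lab_app c i <> 0) ->
    in_crown (c * g)%g /\ forall i, 0 < i <= n -> lab_app (c * g)%g i <> 0.
  move=> gh cc c_full; split.
    by apply: in_crownM => //; have [] := symmetry_inverse_pair g h gh.
  case: gh => _ _ _ g_ok _ i i_in; rewrite lab_appM.
  by have [_ /g_ok[]] := lab_app_range c i (c_full i i_in).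
have a1_odd : odd (lab_app a 1).
  have := a_cr 1 2 (a_full 1 ltac:(lia)) (a_full 2 ltac:(lia)).
  by rewrite /crown_lab /=; case: (odd (lab_app a 1)).
have [_ a1_in] := lab_app_range a 1 (a_full 1 ltac:(lia)).
have one_in : 0 < 1 <= n by lia.
have [g [g' [gg' ga1]]] := rotation_pair (lab_app a 1) 1 a1_in one_in a1_odd.
apply: (sgen_symmetryr _ _ _ gg'); have [cag ag_full] := symM a g g' gg' ca a_full.
have ag1 : lab_app (a * g)%g 1 = 1 by rewrite lab_appM.
move: (a * g)%g cag ag_full ag1 => b cb b_full b1 {g g' gg' ga1 a1_in a1_odd a_inj a_cr a ca a_full}.
have [b_inj b_cr] := cb.
have b2 : lab_app b 2 = 2 \/ lab_app b 2 = n.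
  have b2 := b_full 2 ltac:(lia); have := b_cr 1 2 (b_full 1 one_in) b2.
  by rewrite b1 /crown_lab /=; lia.
case: b2 => [|b2]; first exact: fix12.
(* This reflection fixes 1 and exchanges 2 with [n]. *)
have [||r [rr rE]] := reflection_pair 2; [lia|lia|].
apply: (sgen_symmetryr _ _ _ rr); have [cbr br_full] := symM b r r rr cb b_full.
apply: fix12 => //; rewrite lab_appM ?b1 ?b2.
  by have := rE 1 one_in; lia.
by have := rE n ltac:(lia); lia.
Qed.

Lemma sgen_parity_preserving a b : inverse_pair a b ->
  parity_preserving a -> parity_preserving b -> a \in S /\ b \in S.
Proof.
move=> ab a_odd b_odd; have [mi ca cb] := ab.
have [/hasP[p]|/hasPn a_full] := boolP (has (fun q => lab_app a q == 0) (iota 1 n)).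
  rewrite mem_iota add1n ltnS => p_in /eqP ap.
  have [q [q_in pq_odd bq]] := parity_hole b a p (mutual_inverse_sym _ _ mi) b_odd p_in ap.
  exact: (sgen_hole a b p q).
have {}a_full i : 0 < i <= n -> lab_app a i <> 0.
  by move=> i_in; apply/eqP/a_full; rewrite mem_iota add1n ltnS.
split; apply: sgen_full => // i i_in bi.
have [q [q_in _ aq]] := parity_hole a b i mi a_odd i_in bi.
exact: (a_full q).
Qed.

(** * Parity-changing maps *)

Lemma symmetry_pairM g h k l : symmetry_pair g h -> symmetry_pair k l ->
  symmetry_pair (g * k)%g (l * h)%g.
Proof.
case=> gS hS gh g_ok h_ok [kS lS kl k_ok l_ok].
split; [exact: sgenM | exact: sgenM | exact: mutual_inverseM | |] => i i_in.
  have [gi <-] := g_ok i i_in; have [_ /k_ok] := lab_app_range g i gi.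
  by rewrite lab_appM.
have [li <-] := l_ok i i_in; have [_ /h_ok] := lab_app_range l i li.
by rewrite lab_appM.
Qed.

Lemma delta_inverse k : 1 <= k <= n %/ 4 -> mutual_inverse (delta_o n k) (delta_e n k).
Proof.
move=> k_in; have [k_gt0 k_le] : 0 < k /\ 2 * k <= n - 2 by lia.
split=> i i_neq0; have [i_in j_in] := lab_app_range _ i i_neq0.
  have := delta_oE k i k_gt0 k_le i_in; move: (lab_app _ i) i_neq0 j_in => j j0 j_in jE.
  by have jE' := delta_eE k j k_gt0 k_le j_in; clear k_in n_even; cases_lia.
have := delta_eE k i k_gt0 k_le i_in; move: (lab_app _ i) i_neq0 j_in => j j0 j_in jE.
by have jE' := delta_oE k j k_gt0 k_le j_in; clear k_in n_even; cases_lia.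
Qed.

(** The profile of a [delta] with parity-changing point [p]: besides the two neighbours of [p], one
    more point [c] is removed. *)
Definition flips_parity p c (a : ptrans n) := forall i, 0 < i <= n ->
  (lab_app a i == 0) = [|| i == c, crown_lab n i p | crown_lab n p i] /\
  (lab_app a i <> 0 -> odd (lab_app a i) = odd i (+) (i == p)).

Lemma delta_o_flips k : 1 <= k <= n %/ 4 ->
  flips_parity 2 (n + 2 - 2 * k) (delta_o n k).
Proof.
move=> k_in i i_in; have [k_gt0 k_le] : 0 < k /\ 2 * k <= n - 2 by lia.
have := delta_oE k i k_gt0 k_le i_in; clear k_in; move: (lab_app _ i) => j jE.
by case: jE => [[[i1|[i3|i2]] j0]|[[i2 j1]|[[i4 [i_le j2]]|[i_ge j2]]]];
   rewrite /crown_lab; split; lia.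
Qed.

Lemma delta_e_flips k : 1 <= k <= n %/ 4 -> flips_parity 1 (2 * k + 1) (delta_e n k).
Proof.
move=> k_in i i_in; have [k_gt0 k_le] : 0 < k /\ 2 * k <= n - 2 by lia.
have := delta_eE k i k_gt0 k_le i_in; clear k_in; move: (lab_app _ i) => j jE.
by case: jE => [[[i1|[i3|i2]] j0]|[[i2 j1]|[[i4 j2]|[i_ge j2]]]];
   rewrite /crown_lab; split; lia.
Qed.

Lemma delta_o_hole c : ~~ odd c -> c <= n -> n + 2 - 2 * (n + 2 - c)./2 = c.
Proof. by move=> c_even c_le; clear n_ge4; lia. Qed.

(** A rotation brings [p] to the point moved by the [delta]s, and the position of [c] determines the
    index. An index above [n %/ 4] is replaced by its complement to [n / 2], through the reflection
    that fixes the moved point. *)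
Lemma delta_move p c : 0 < p <= n -> 0 < c <= n -> odd p = odd c -> p <> c ->
  exists a b, [/\ a \in S, b \in S, mutual_inverse a b & flips_parity p c a].
Proof.
move=> p_in c_in pc_odd p_c.
suff [g [h [a [b [gh [aS bS ab a_flip]]]]]] : exists g h a b, symmetry_pair g h /\
    [/\ a \in S, b \in S, mutual_inverse a b & flips_parity (lab_app g p) (lab_app g c) a].
  have [gS hS [gK hK] g_ok h_ok] := gh.
  exists (g * a)%g, (b * h)%g; split; [exact: sgenM | exact: sgenM | exact: mutual_inverseM |].
  move=> i i_in; have [gi gi_odd] := g_ok i i_in; have [_ gi_in] := lab_app_range g i gi.
  have [a0 a_odd] := a_flip _ gi_in; rewrite lab_appM a0 gi_odd in a_odd *.
  have [_ [g_inj g_cr] _] := symmetry_inverse_pair g h gh.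
  have g_eq j : (lab_app g i == lab_app g j) = (i == j).
    by apply/eqP/eqP => [/(g_inj _ _ gi)|->].
  rewrite !g_eq in a_odd *.
  by rewrite (g_cr i p) ?(g_cr p i) //; have [] := g_ok p p_in.
(* [delta_e] changes the parity of 1 and [delta_o] that of 2. *)
have [B [B_def B_odd]] : exists B, (B = 1 \/ B = 2) /\ odd p = odd B.
  by have [p_odd|p_even] := boolP (odd p); [exists 1 | exists 2]; lia.
have B_in : 0 < B <= n by lia.
have [g [h [gh gp]]] := rotation_pair p B p_in B_in B_odd.
have [r [rr rE]] : exists r, symmetry_pair r r /\ forall i, 0 < i <= n ->
    0 < lab_app r i <= n /\ (lab_app r i + i = 2 * B \/ lab_app r i + i = 2 * B + n).
  by apply: reflection_pair; lia.
have [gc gc_odd] : lab_app g c <> 0 /\ odd (lab_app g c) = odd B.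
  by case: gh => _ _ _ /(_ c c_in)[? ->] _; rewrite -pc_odd.
have [_ gc_in] := lab_app_range g c gc.
have gc_B : lab_app g c <> B.
  have [_ [g_inj _] _] := symmetry_inverse_pair g h gh.
  by rewrite -gp => /(g_inj _ _ gc) c_p; apply: p_c.
have [rgc_in rgc] := rE _ gc_in; have [rB_in rB] := rE B B_in.
have {}rB : lab_app r B = B by clear - B_in rB_in rB; lia.
have gr_p : lab_app (g * r)%g p = B by rewrite lab_appM gp.
have grr := symmetry_pairM _ _ _ _ gh rr.
case: B_def gp gc_B rgc gr_p gc_odd {B_in B_odd rE rB rB_in} => -> gp gc_B rgc gr_p gc_odd.
  have [k_le|k_gt] := leqP (lab_app g c)./2 (n %/ 4).
    have k_in : 1 <= (lab_app g c)./2 <= n %/ 4 by clear - k_le gc_in gc_odd gc_B; lia.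
    exists g, h, (delta_e n (lab_app g c)./2), (delta_o n (lab_app g c)./2).
    split=> //; split; [exact/sgen_gen/genG_delta_e | exact/sgen_gen/genG_delta_o | |].
      exact/mutual_inverse_sym/delta_inverse.
    rewrite gp; have := delta_e_flips _ k_in.
    by have -> : 2 * (lab_app g c)./2 + 1 = lab_app g c by clear - gc_odd; lia.
  set k := (lab_app r (lab_app g c))./2; have k_in : 1 <= k <= n %/ 4.
    by rewrite /k; clear - k_gt rgc rgc_in gc_in gc_odd gc_B n_even; lia.
  exists (g * r)%g, (r * h)%g, (delta_e n k), (delta_o n k).
  split=> //; split; [exact/sgen_gen/genG_delta_e | exact/sgen_gen/genG_delta_o | |].
    exact/mutual_inverse_sym/delta_inverse.
  rewrite gr_p lab_appM; have := delta_e_flips _ k_in.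
  by have -> : 2 * k + 1 = lab_app r (lab_app g c) by rewrite /k; clear - rgc gc_odd n_even; lia.
have [k_le|k_gt] := leqP (n + 2 - lab_app g c)./2 (n %/ 4).
  set k := (n + 2 - lab_app g c)./2; have k_in : 1 <= k <= n %/ 4.
    by rewrite /k k_le andbT; clear - gc_in; lia.
  exists g, h, (delta_o n k), (delta_e n k).
  split=> //; split; [exact/sgen_gen/genG_delta_o | exact/sgen_gen/genG_delta_e | exact: delta_inverse |].
  rewrite gp; have := delta_o_flips _ k_in.
  rewrite /k delta_o_hole //; first by rewrite gc_odd.
  by case/andP: gc_in.
set k := (n + 2 - lab_app r (lab_app g c))./2; have k_in : 1 <= k <= n %/ 4.
  have gc_gt : 4 <= lab_app g c by clear - gc_in gc_odd gc_B; lia.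
  by rewrite /k; clear - k_gt rgc rgc_in gc_in gc_gt gc_odd n_even; lia.
exists (g * r)%g, (r * h)%g, (delta_o n k), (delta_e n k).
split=> //; split; [exact/sgen_gen/genG_delta_o | exact/sgen_gen/genG_delta_e | exact: delta_inverse |].
rewrite gr_p lab_appM; have := delta_o_flips _ k_in.
rewrite /k delta_o_hole //; last by case/andP: rgc_in.
by clear - rgc gc_odd n_even; lia.
Qed.

Definition changes (a : ptrans n) i := (lab_app a i != 0) && (odd (lab_app a i) != odd i).

Definition changed_points (a : ptrans n) := [seq i <- iota 1 n | changes a i].

Lemma mem_changed_points a i : (i \in changed_points a) = changes a i.
Proof.
rewrite mem_filter mem_iota add1n ltnS; apply: andb_idr => /andP[/eqP ai _].
by have [] := lab_app_range a i ai.
Qed.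

Lemma uniq_changed_points a : uniq (changed_points a).
Proof. by rewrite filter_uniq ?iota_uniq. Qed.

Lemma size_changed_points a b : mutual_inverse a b ->
  size (changed_points a) <= size (changed_points b).
Proof.
case=> aK _; rewrite -(size_map (lab_app a)); apply: uniq_leq_size.
  rewrite map_inj_in_uniq ?uniq_changed_points // => i j.
  rewrite !mem_changed_points => /andP[/eqP ai _] /andP[/eqP aj _] eq_a.
  by rewrite -(aK i ai) eq_a aK.
move=> _ /mapP[i i_ch ->]; move: i_ch; rewrite !mem_changed_points => /andP[/eqP ai ai_odd].
have [/andP[i_gt0 _] _] := lab_app_range a i ai.
by rewrite /changes aK // -lt0n i_gt0 eq_sym.
Qed.

(** A comparability determines the parities of both its points; one between [p] and a point of the
    domain would be kept by [a], and so would the parity of [p]. *)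
Lemma changes_isolated a p i : in_crown a -> changes a p -> lab_app a i <> 0 ->
  crown_lab n i p = false /\ crown_lab n p i = false.
Proof.
have crown_odd u v : crown_lab n u v -> odd u /\ ~~ odd v by rewrite /crown_lab; lia.
case=> _ a_cr /andP[/eqP ap ap_odd] ai; split; apply/negP=> cr.
  have cr' := cr; rewrite a_cr // in cr'.
  by have [_ h1] := crown_odd _ _ cr; have [_ h2] := crown_odd _ _ cr'; lia.
have cr' := cr; rewrite a_cr // in cr'.
by have [h1 _] := crown_odd _ _ cr; have [h2 _] := crown_odd _ _ cr'; lia.
Qed.

(** The move [d] is undefined only at [c] and at the neighbours of [p], all outside the domain of
    [a]; hence nothing is lost and [a = d * (e * a)]. In [b * d] the point [lab_app a p] is no
    longer changed, and no new changed point arises. *)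
Lemma change_move a b p c : inverse_pair a b -> changes a p ->
    0 < c <= n -> odd p = odd c -> lab_app a c = 0 ->
  exists d e, [/\ inverse_pair (b * d)%g (e * a)%g,
     size (changed_points (b * d)%g) < size (changed_points b)
   & (b * d)%g \in S /\ (e * a)%g \in S -> a \in S /\ b \in S].
Proof.
move=> [[aK bK] ca cb] p_ch c_in pc_odd ac; have /andP[/eqP ap ap_odd] := p_ch.
have [p_in ap_in] := lab_app_range a p ap.
have p_c : p <> c by move=> p_c; rewrite p_c in ap.
have [d [e [dS eS de d_flip]]] := delta_move p c p_in c_in pc_odd p_c.
have [dK eK] := de.
have d_def i : lab_app a i <> 0 -> lab_app d i <> 0.
  move=> ai; have [i_in _] := lab_app_range a i ai; have [d0 _] := d_flip i i_in.
  apply/eqP; rewrite d0; have [-> ->] := changes_isolated a p i ca p_ch ai.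
  by rewrite !orbF; apply/eqP=> i_c; rewrite i_c in ai.
have bd0 i : lab_app b i = 0 -> lab_app (b * d)%g i = 0.
  by move=> bi; rewrite lab_appM bi lab_app_out; auto.
have b_a i : lab_app b i <> 0 -> lab_app a (lab_app b i) <> 0.
  by move=> bi; rewrite bK // => i0; rewrite i0 lab_app_out in bi; auto.
exists d, e; split.
- apply: inverse_pairM; first by split.
  by split=> //; apply: sgen_in_crown.
- rewrite -[leqLHS]/(size (lab_app a p :: changed_points (b * d)%g)).
  apply: uniq_leq_size => [|i].
    rewrite cons_uniq uniq_changed_points andbT mem_changed_points /changes lab_appM aK //.
    have [_ d_odd] := d_flip p p_in; rewrite d_odd ?eqxx ?addbT; last exact: d_def.
    by case: (odd p) (odd (lab_app a p)) ap_odd => -[]; rewrite ?andbF.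
  rewrite inE => /orP[/eqP->|]; rewrite mem_changed_points.
    by rewrite /changes aK // [odd p == _]eq_sym ap_odd andbT; lia.
  case/andP=> /eqP bdi bdi_odd; rewrite mem_changed_points /changes.
  have [bi|/eqP bi] := eqVneq (lab_app b i) 0; first by have := bd0 i bi.
  have [bi_in _] := lab_app_range d (lab_app b i) ltac:(by rewrite -lab_appM).
  have [_ d_odd] := d_flip _ bi_in.
  rewrite lab_appM d_odd in bdi_odd; last exact/d_def/b_a.
  have [bi_p|bi_p] := eqVneq (lab_app b i) p; last first.
    by rewrite /= -[odd (lab_app b i)]addbF -(negPf bi_p).
  by rewrite /= bi_p eq_sym -{1}(bK i bi) bi_p.
case=> bdS eaS; split.
  suff -> : a = (d * (e * a))%g by apply: sgenM.
  apply: lab_app_inj => i; rewrite !lab_appM.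
  have [ai|/eqP ai] := eqVneq (lab_app a i) 0; last by rewrite dK //; apply: d_def.
  have [di|/eqP di] := eqVneq (lab_app d i) 0; last by rewrite dK.
  by rewrite ai di !lab_app_out; auto.
suff -> : b = (b * d * e)%g by apply: sgenM.
apply: lab_app_inj => i; rewrite !lab_appM.
have [bi|/eqP bi] := eqVneq (lab_app b i) 0; last by rewrite dK //; apply/d_def/b_a.
by rewrite bi !lab_app_out; auto.
Qed.

(** * Maps from one parity class to the other *)

Lemma eta_pair p : exists d e,
  [/\ d \in S, e \in S, mutual_inverse d e
    & forall i, 0 < i <= n -> if odd i == odd p
        then lab_app d i <> 0 /\ odd (lab_app d i) <> odd p /\ lab_app e i = 0
        else lab_app d i = 0 /\ lab_app e i <> 0 /\ odd (lab_app e i) = odd p].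
Proof.
have eta12 : mutual_inverse (eta1 n) (eta2 n).
  split=> i i_neq0; have [i_in j_in] := lab_app_range _ i i_neq0.
    have := eta1E i i_in; move: (lab_app _ i) i_neq0 j_in => j j0 j_in jE.
    by have := eta2E j j_in; lia.
  have := eta2E i i_in; move: (lab_app _ i) i_neq0 j_in => j j0 j_in jE.
  by have := eta1E j j_in; lia.
have h1S := sgen_gen _ (genG_eta1); have h2S := sgen_gen _ (genG_eta2).
have [p_odd|p_even] := boolP (odd p).
  exists (eta1 n), (eta2 n); split=> // i i_in.
  by have := eta1E i i_in; have := eta2E i i_in; case: eqP; lia.
exists (eta2 n), (eta1 n); split=> //; first exact: mutual_inverse_sym.
by move=> i i_in; have := eta1E i i_in; have := eta2E i i_in; case: eqP; lia.
Qed.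

(** Following [a] by the [eta] that returns to the class of [p] gives a parity-preserving map, and
    the opposite [eta] undoes this on the image of [a]. *)
Lemma sgen_switch a b p : inverse_pair a b ->
    (forall i, lab_app a i <> 0 -> odd i = odd p /\ odd (lab_app a i) <> odd p) ->
  a \in S /\ b \in S.
Proof.
move=> [[aK bK] ca cb] a_switch.
have [d [e [dS eS de deE]]] := eta_pair p; have [dK eK] := de.
have ae : inverse_pair (a * e)%g (d * b)%g.
  apply: inverse_pairM; first by split.
  by split; [apply: mutual_inverse_sym | apply: sgen_in_crown | apply: sgen_in_crown].
have b_switch i : lab_app b i <> 0 -> odd (lab_app b i) = odd p /\ odd i <> odd p.
  move=> bi; have := a_switch (lab_app b i); rewrite bK //; apply.
  by move=> i0; rewrite i0 lab_app_out in bi; auto.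
have ae_odd : parity_preserving (a * e)%g.
  move=> i; rewrite lab_appM => aei.
  have ai : lab_app a i <> 0 by move=> ai; rewrite ai lab_app_out in aei; auto.
  have [i_odd ai_odd] := a_switch i ai; have [_ ai_in] := lab_app_range a i ai.
  by have := deE _ ai_in; rewrite (introF eqP ai_odd) i_odd => -[_ []].
have db_odd : parity_preserving (d * b)%g.
  move=> i; rewrite lab_appM => dbi.
  have di : lab_app d i <> 0 by move=> di; rewrite di lab_app_out in dbi; auto.
  have [-> _] := b_switch _ dbi; have [i_in _] := lab_app_range d i di.
  by have := deE i i_in; case: eqP => // _ [].
have [aeS dbS] := sgen_parity_preserving _ _ ae ae_odd db_odd.
have a_e i : lab_app a i <> 0 -> lab_app e (lab_app a i) <> 0.
  move=> ai; have [_ ai_odd] := a_switch i ai; have [_ ai_in] := lab_app_range a i ai.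
  by have := deE _ ai_in; rewrite (introF eqP ai_odd) => -[_ []].
split.
  suff -> : a = (a * e * d)%g by apply: sgenM.
  apply: lab_app_inj => i; rewrite !lab_appM.
  have [->|/eqP ai] := eqVneq (lab_app a i) 0; first by rewrite !lab_app_out; auto.
  by rewrite eK //; apply: a_e.
suff -> : b = (e * (d * b))%g by apply: sgenM.
apply: lab_app_inj => i; rewrite !lab_appM.
have [bi|/eqP bi] := eqVneq (lab_app b i) 0.
  have [ei|/eqP ei] := eqVneq (lab_app e i) 0; last by rewrite eK.
  by rewrite ei bi !lab_app_out; auto.
have [_ i_odd] := b_switch i bi; have [i_in _] := lab_app_range b i bi.
by have := deE i i_in; rewrite (introF eqP i_odd) => -[_ [/eK ->]].
Qed.

Definition next (i : nat) := if i == n then 1 else i.+1.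

Lemma nextE i : i = n /\ next i = 1 \/ i <> n /\ next i = i.+1.
Proof. by rewrite /next; case: eqP; auto. Qed.

Lemma next_crown i : 0 < i <= n -> crown_lab n i (next i) \/ crown_lab n (next i) i.
Proof. by move=> i_in; have := nextE i; rewrite /crown_lab; lia. Qed.

Lemma next2 i : 0 < i -> i + 2 <= n -> next (next i) = i + 2.
Proof. by have := nextE i; have := nextE (next i); lia. Qed.

Lemma next2_wrap i : i = 1 \/ i = 2 -> next (next (i + n - 2)) = i.
Proof. by have := nextE (i + n - 2); have := nextE (next (i + n - 2)); lia. Qed.

Lemma next2_closed (P : nat -> Prop) q : 0 < q <= n ->
    (forall i, 0 < i <= n -> odd i = odd q -> P (next (next i)) -> P i) ->
  forall i, 0 < i <= n -> odd i = odd q -> P i -> P q.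
Proof.
move=> q_in PN.
have down t i : 0 < i -> i + 2 * t <= n -> odd i = odd q -> P (i + 2 * t) -> P i.
  elim: t i => [|t IHt] i i_gt0 i_le i_odd Pi; first by rewrite muln0 addn0 in Pi.
  apply: PN; [lia | by [] | rewrite next2; [|by []|lia]].
  have e : i + 2 * t.+1 = i + 2 + 2 * t by lia.
  by apply: IHt; [lia | lia | rewrite oddD addbF | rewrite -e].
move=> i i_in i_odd Pi.
have [u [t [u_12 def_i u_odd]]] : exists u t, [/\ u = 1 \/ u = 2, i = u + 2 * t & odd u = odd q].
  rewrite -{}i_odd; have [iO|iE] := boolP (odd i).
    by exists 1, i./2; split; lia.
  by exists 2, (i./2).-1; split; lia.
(* The walk goes down from [i] to the least label [u] of the class, wraps to the greatest one, and
   goes down again to [q]. *)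
have Pu : P u by apply: (down t); [lia | lia | by [] | rewrite -def_i].
have Ptop : P (u + n - 2).
  by apply: PN; [lia | rewrite -u_odd; clear - u_12 n_even n_ge4; lia | rewrite next2_wrap].
have q_top : q + 2 * (u + n - 2 - q)./2 = u + n - 2.
  by clear - u_12 u_odd q_in n_even n_ge4; lia.
by apply: (down (u + n - 2 - q)./2); [lia | lia | by [] | rewrite q_top].
Qed.

(* [f] sends a point [j] of the other class to its preimage if that is changed, and
   to the successor of its preimage otherwise.  It is injective, hence onto the
   class of [p]; so if [a] were defined at a point of the other class, it would be
   defined at all of them, in particular next to [p]. *)
Lemma saturated_switch a b p : inverse_pair a b -> changes a p ->
    (forall c, 0 < c <= n -> odd c = odd p -> lab_app a c <> 0) ->
    (forall c, 0 < c <= n -> odd c <> odd p -> lab_app b c <> 0) ->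
  forall i, lab_app a i <> 0 -> odd i = odd p /\ odd (lab_app a i) <> odd p.
Proof.
move=> [[aK bK] ca cb] p_ch a_full b_full.
have /andP[/eqP ap ap_odd] := p_ch; have [p_in _] := lab_app_range a p ap.
have next_in i : 0 < i <= n -> 0 < next i <= n by have := nextE i; lia.
have next_odd i : 0 < i <= n -> odd (next i) = ~~ odd i by have := nextE i; lia.
have next_inj i j : next i = next j -> 0 < i <= n -> 0 < j <= n -> i = j.
  by have := nextE i; have := nextE j; lia.
have alone i : changes a i -> lab_app a (next i) <> 0 -> False.
  move=> i_ch ani; have [i_in _] := lab_app_range a i ltac:(by case/andP: i_ch => /eqP).
  have [n1 n2] := changes_isolated a i _ ca i_ch ani.
  by case: (next_crown i i_in); rewrite ?n1 ?n2.
have alone_next i : changes a (next i) -> lab_app a i <> 0 -> False.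
  move=> i_ch ani; have [i_in _] := lab_app_range a i ani.
  have [n1 n2] := changes_isolated a _ _ ca i_ch ani.
  by case: (next_crown i i_in); rewrite ?n1 ?n2.
pose q := next p; have q_in : 0 < q <= n by apply: next_in.
have q_odd : odd q = ~~ odd p by apply: next_odd.
have b_def j : j \in parity_class q -> 0 < j <= n /\ lab_app b j <> 0.
  rewrite mem_parity_class => /andP[/eqP j_odd j_in]; split=> //.
  by apply: b_full => //; rewrite j_odd q_odd; case: (odd p).
have a_b j : j \in parity_class q -> 0 < lab_app b j <= n /\ lab_app a (lab_app b j) = j.
  by case/b_def=> j_in bj; rewrite bK //; have [_] := lab_app_range b j bj.
pose f j := if odd (lab_app b j) == odd p then lab_app b j else next (lab_app b j).
have size_class u : 0 < u <= n -> size (parity_class u) <= size (parity_class (next u)).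
  move=> u_in; rewrite -(size_map next); apply: uniq_leq_size.
    rewrite map_inj_in_uniq ?filter_uniq ?iota_uniq // => i j.
    by rewrite !mem_parity_class => /andP[_ i_in] /andP[_ j_in] /next_inj; apply.
  move=> _ /mapP[i i_u ->]; move: i_u; rewrite !mem_parity_class => /andP[/eqP i_odd i_in].
  by rewrite next_in // !next_odd // i_odd eqxx.
have f_changes j : j \in parity_class q -> odd (lab_app b j) = odd p -> changes a (lab_app b j).
  move=> j_q bj_odd; have [bj_in abj] := a_b j j_q.
  move: j_q; rewrite /changes abj mem_parity_class => /andP[/eqP j_odd j_in].
  by rewrite j_odd bj_odd q_odd; case: (odd p); lia.
have f_uniq : uniq (map f (parity_class q)).
  rewrite map_inj_in_uniq ?filter_uniq ?iota_uniq // => i j i_q j_q.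
  have [bi_in abi] := a_b i i_q; have [bj_in abj] := a_b j j_q.
  have [i_in bi] := b_def i i_q; have [j_in bj] := b_def j j_q.
  rewrite /f; case: eqP => bi_odd; case: eqP => bj_odd eq_f.
  - by rewrite -abi eq_f.
  (* A collision between the two branches of [f] would put a changed point right after a point of
     the domain. *)
  - case: (alone_next (lab_app b j)); last by rewrite abj; lia.
    by rewrite -eq_f; apply: f_changes.
  - case: (alone_next (lab_app b i)); last by rewrite abi; lia.
    by rewrite eq_f; apply: f_changes.
  by rewrite -abi (next_inj _ _ eq_f).
have f_sub : {subset map f (parity_class q) <= parity_class p}.
  move=> _ /mapP[j j_q ->]; have [bj_in abj] := a_b j j_q.
  rewrite mem_parity_class /f; have [bj_odd|bj_odd] := eqVneq (odd (lab_app b j)) (odd p).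
    by rewrite bj_odd eqxx.
  rewrite next_in // next_odd // andbT.
  by case: (odd _) (odd p) bj_odd => -[].
have f_onto e : 0 < e <= n -> odd e = odd p -> exists2 j, j \in parity_class q & e = f j.
  move=> e_in e_odd; have size_f : size (parity_class p) <= size (map f (parity_class q)).
    by rewrite size_map; apply: size_class.
  have [_ eq_p] := uniq_min_size f_uniq f_sub size_f.
  have : e \in map f (parity_class q) by rewrite eq_p mem_parity_class e_odd eqxx.
  by case/mapP=> j j_q ->; exists j.
(* The point [next i] is a value of [f]. It is not changed, having a neighbour in the domain, so it
   is the successor of a preimage, which is [i]. *)
have step i : 0 < i <= n -> odd i = odd q -> lab_app a (next (next i)) <> 0 -> lab_app a i <> 0.
  move=> i_in i_odd ani.
  have [j j_q eq_e] := f_onto (next i) (next_in i i_in) ltac:(by rewrite next_odd // i_odd q_odd negbK).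
  have [bj_in abj] := a_b j j_q; have [j_in _] := b_def j j_q.
  move: eq_e; rewrite /f; case: eqP => bj_odd eq_e; last first.
    by rewrite (next_inj _ _ eq_e) // abj; lia.
  by case: (alone (next i)) => //; rewrite eq_e; apply: f_changes.
have class_p i : lab_app a i <> 0 -> odd i = odd p.
  move=> ai; have [i_in _] := lab_app_range a i ai.
  apply/eqP/negPn/negP=> i_odd; have {}i_odd : odd i = odd q.
    by rewrite q_odd; case: (odd i) (odd p) i_odd => -[].
  apply: (alone p p_ch); rewrite -/q.
  exact: (next2_closed (fun i => lab_app a i <> 0) q q_in step i).
move=> i ai; have i_odd := class_p i ai; split=> //.
have [i_in _] := lab_app_range a i ai; have [j j_q] := f_onto i i_in i_odd.
have [bj_in abj] := a_b j j_q; have [j_in _] := b_def j j_q.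
have bj_odd : odd (lab_app b j) = odd p by apply: class_p; rewrite abj; lia.
rewrite /f bj_odd eqxx => ->; have /andP[_] := f_changes j j_q bj_odd.
by rewrite bj_odd => /eqP.
Qed.

(** Induction on the number of changed points, which is the same for [a] and [b]; a move on either
    side therefore lowers the measure. With no changed point left, or no hole for a move, the
    earlier cases apply. *)
Lemma inverse_pair_sgen a b : inverse_pair a b -> a \in S /\ b \in S.
Proof.
have [m] := ubnP (size (changed_points a)); elim: m a b => // m IHm a b size_a ab.
have [mi ca cb] := ab; have [aK bK] := mi.
have size_ab := size_changed_points _ _ mi.
have size_ba := size_changed_points _ _ (mutual_inverse_sym _ _ mi).
have [/hasP[p _ p_ch]|/hasPn no_ch] := boolP (has (changes a) (iota 1 n)); last first.
  have a_odd : parity_preserving a.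
    move=> i ai; have [i_in _] := lab_app_range a i ai.
    have := no_ch i; rewrite mem_iota add1n ltnS => /(_ i_in).
    by rewrite /changes negb_and !negbK => /orP[] /eqP.
  apply: sgen_parity_preserving => // i bi; have ai := bK i bi.
  rewrite -[in RHS]ai a_odd // ai => i0.
  by rewrite i0 lab_app_out in bi; auto.
have /andP[/eqP ap ap_odd] := p_ch; have [p_in ap_in] := lab_app_range a p ap.
have [/hasP[c]|/hasPn a_full] := boolP (has (fun c => lab_app a c == 0) (parity_class p)).
  rewrite mem_parity_class => /andP[/eqP c_odd c_in] /eqP ac.
  have [d [e [bd size_bd sgen_bd]]] := change_move a b p c ab p_ch c_in (esym c_odd) ac.
  by apply: sgen_bd; apply: IHm => //; lia.
have [/hasP[c]|/hasPn b_full] := boolP (has (fun c => lab_app b c == 0) (parity_class (lab_app a p))).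
  rewrite mem_parity_class => /andP[/eqP c_odd c_in] /eqP bc.
  have ap_ch : changes b (lab_app a p).
    by rewrite /changes aK // [odd p == _]eq_sym ap_odd andbT; lia.
  have ba := inverse_pair_sym _ _ ab.
  have [d [e [ad size_ad sgen_ad]]] := change_move b a _ c ba ap_ch c_in (esym c_odd) bc.
  suff [] : b \in S /\ a \in S by [].
  by apply: sgen_ad; apply: IHm => //; lia.
apply: (sgen_switch a b p) => //; apply: (saturated_switch a b p) => // c c_in c_odd.
  by apply/eqP/a_full; rewrite mem_parity_class c_odd eqxx.
apply/eqP/b_full; rewrite mem_parity_class c_in andbT.
by case: (odd c) (odd p) (odd (lab_app a p)) c_odd ap_odd => -[] [].
Qed.

End Crown.

Theorem theorem2p18 (n : nat) (hn : 4 <= n) (hn_even : ~~ odd n) :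
  IC n = sgen (genG n).
Proof.
apply/setP=> a; apply/idP/idP=> [/ICP ca|/(sgen_in_crown n hn hn_even)/ICP //].
have [b ab cb] := mutual_inverse_ex a ca.
by have [] := inverse_pair_sgen n hn hn_even a b (And3 ab ca cb).
Qed.
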